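(* For every natural number $k$ and every real $c>0$ there is a threshold $n_0=n_0(k,c)$ such that the following holds. Let $L$ be a set of $n\geq n_0$ distinct lines in the Euclidean plane $\mathbb{R}^2$ and let $P$ be a set of $n$ distinct points in $\mathbb{R}^2$. If the number of incidences $|\{(p,\ell)\in P\times L : p\in \ell\}|$ is at least $cn^{4/3}$, then there exist $k$ points $p_1,\dots,p_k\in P$ in general position (no three of them collinear) such that for every pair $i\neq j$ there is a line $\ell\in L$ with $p_i\in\ell$ and $p_j\in\ell$.
   Context: An incidence between a point $p$ and a line $\ell$ means $p\in\ell$. A set of points is in general position if no three of its elements are collinear. *)

(* Defs.v *)
From HB Require Import structures.
From mathcomp Require Import all_boot all_order all_algebra finmap.
From mathcomp Require Import boolp classical_sets reals exp.

Set Implicit Arguments.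
Unset Strict Implicit.
Unset Printing Implicit Defensive.

Import Order.TTheory GRing.Theory Num.Theory.
Local Open Scope classical_set_scope.
Local Open Scope fset_scope.
Local Open Scope ring_scope.

Definition is_line (R : realType) (l : set (R * R)) : Prop :=
  exists a b c : R,
    (a, b) <> (0, 0) /\ l = [set p : R * R | a * p.1 + b * p.2 = c]%classic.

Definition collinear3 (R : realType) (p q r : R * R) : Prop :=
  exists2 l : set (R * R), is_line l & [/\ l p, l q & l r].

Definition general_position (R : realType) (S : {fset R * R}) : Prop :=
  forall p q r : R * R, p \in S -> q \in S -> r \in S ->
    p <> q -> p <> r -> q <> r -> ~ collinear3 p q r.

Definition incidences (R : realType) (P : {fset R * R})
    (L : {fset set (R * R)}) : {fset (R * R) * set (R * R)} :=
  [fset x in (P `*` L)%fset | x.1 \in x.2]%fset.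

(* Main.v *)
(** Take a random sample [S] of about [delta n^(1/3)] lines and the vertical
    decomposition of its arrangement.  Backwards analysis shows that on average the
    lines meet [O(n |S|)] trapezoids in total, and that the trapezoid of a given point
    is met by [O(n / |S|)] lines.  After cutting each trapezoid into groups of at most
    [M n^(1/3)] points, the (line, group) pairs with fewer than [2k] incidences carry
    only a small part of all the incidences, so some group of [m] points, [m] of order
    [n^(1/3)], has at least [c1 m^2] incidences on lines containing at least [2k] of its
    points.

    In such a group join two points when they lie on a common line with at most
    [eps0 m] points.  Each line gives a clique, these cliques are edge-disjoint and cover
    a positive proportion of all pairs, so after deleting the pairs that a regularity
    partition does not control, [k] points of some line survive pairwise.  Their
    classes are pairwise regular of positive density, and a greedy choice in these classes
    yields a clique that avoids the (short) lines spanned by the points already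
    chosen. *)

Require Import Defs.
From mathcomp Require Import all_boot all_order all_algebra.
From mathcomp Require Import boolp ring lra zify.

Set Implicit Arguments.
Unset Strict Implicit.
Unset Printing Implicit Defensive.

Import Order.TTheory GRing.Theory Num.Theory.
Local Open Scope ring_scope.

(** * A lower-regularity lemma *)

Definition edges (X : finType) (f : rel X) (A B : {set X}) : nat :=
  (\sum_(x in A) \sum_(y in B) f x y)%N.

(** Only a lower bound on the density of large subrectangles is asked for; the greedy choice of a
    clique needs nothing more. *)
Definition lower_regular (R : numDomainType) (X : finType) (f : rel X)
    (eps eta : R) (A B : {set X}) : bool :=
  [forall A' : {set X}, forall B' : {set X},
    [&& A' \subset A, B' \subset B, eps * #|A|%:R <= #|A'|%:R
      & eps * #|B|%:R <= #|B'|%:R] ==>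
    (eta * (#|A'|%:R * #|B'|%:R) <= (edges f A' B')%:R)].

Definition cell (X C : finType) (phi : X -> C) (c : C) : {set X} :=
  [set x | phi x == c].

Section Regularity.
Variables (R : realFieldType) (X : finType) (f : rel X).

(** The energy of the regularity argument: the squared distance from [f] to a step function whose
    values [h] need not be the cell densities. *)
Definition sqerr (C : finType) (phi : X -> C) (h : C -> C -> R) : R :=
  \sum_x \sum_y ((f x y)%:R - h (phi x) (phi y)) ^+ 2.

Lemma sqerr_ge0 C phi h : 0 <= @sqerr C phi h.
Proof. by apply: sumr_ge0 => x _; apply: sumr_ge0 => y _; apply: sqr_ge0. Qed.

Lemma sum_cells (C : finType) (phi : X -> C) (G : X -> X -> R) :
  \sum_x \sum_y G x y =
  \sum_c \sum_d \sum_(x in cell phi c) \sum_(y in cell phi d) G x y.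
Proof.
rewrite (partition_big phi predT) //=; apply: eq_bigr => c _.
rewrite exchange_big /= (partition_big phi predT) //=.
apply: eq_bigr => d _; rewrite exchange_big /=.
apply: eq_big => [x|x _]; first by rewrite inE.
by apply: eq_bigl => y; rewrite inE.
Qed.

(** The summand is [(f - a - s)^2 - (f - a)^2], the change in squared error when the predicted value
    goes from [a] to [a + s]. *)
Lemma sum_shift (A B : {set X}) (a s : R) :
  \sum_(x in A) \sum_(y in B) (s ^+ 2 - 2 * s * ((f x y)%:R - a)) =
  s ^+ 2 * (#|A|%:R * #|B|%:R)
    - 2 * s * ((edges f A B)%:R - a * (#|A|%:R * #|B|%:R)).
Proof.
have -> : (edges f A B)%:R = \sum_(x in A) \sum_(y in B) (f x y)%:R :> R.
  rewrite natr_sum; apply: eq_bigr => x _; exact: natr_sum.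
have cst (z : R) : z * (#|A|%:R * #|B|%:R) = \sum_(x in A) \sum_(y in B) z.
  under eq_bigr do rewrite sumr_const.
  by rewrite sumr_const -[RHS]mulr_natr -[X in _ = X * _]mulr_natr; ring.
rewrite !cst -sumrB mulr_sumr -sumrB; apply: eq_bigr => x _.
by rewrite -sumrB mulr_sumr -sumrB; apply: eq_bigr => y _.
Qed.

(** The thresholds [eta], [2 * eta], [3 * eta] leave a gap of [eta] between prediction and true
    density in both kinds of misfit. *)
Definition misfit (eps eta : R) (C : finType) (phi : X -> C) (h : C -> C -> R)
    (c d : C) : bool :=
  if 2 * eta <= h c d then ~~ lower_regular f eps eta (cell phi c) (cell phi d)
  else 3 * eta * (#|cell phi c|%:R * #|cell phi d|%:R)
         <= (edges f (cell phi c) (cell phi d))%:R.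

Definition misfit_mass (eps eta : R) (C : finType) phi (h : C -> C -> R) : R :=
  \sum_c \sum_(d | misfit eps eta phi h c d)
    #|cell phi c|%:R * #|cell phi d|%:R.

(** Across a gap of [eta], a shift by [eta] towards the truth gains [eta ^+ 2] times the area of the
    rectangle, which is at least [eps ^+ 2] times that of the pair. A pair that is no misfit gets
    the empty rectangle. *)
Lemma misfit_witness (eps eta : R) (C : finType) (phi : X -> C) h c d :
  0 < eps -> eps <= 1 -> 0 < eta ->
  exists W : {set X} * {set X} * R,
    [/\ W.1.1 \subset cell phi c, W.1.2 \subset cell phi d &
      W.2 ^+ 2 * (#|W.1.1|%:R * #|W.1.2|%:R)
      - 2 * W.2 * ((edges f W.1.1 W.1.2)%:R - h c d * (#|W.1.1|%:R * #|W.1.2|%:R))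
      <= - (if misfit eps eta phi h c d then
             eta ^+ 2 * eps ^+ 2 * (#|cell phi c|%:R * #|cell phi d|%:R)
            else 0)].
Proof.
move=> eps0 eps1 eta0; case: ifPn => [|_]; last first.
  exists (set0, set0, 0); split; rewrite ?sub0set //=.
  by rewrite expr0n /= mul0r mulr0 mul0r subr0 oppr0.
rewrite /misfit; case: ifPn => [h_ge /forallPn[A] /forallPn[B]|].
  rewrite negb_imply -ltNge => /andP[/and4P[sA sB eA eB] eAB].
  exists (A, B, - eta); split => //=.
  have := ler_pM (mulr_ge0 (ltW eps0) (ler0n _ _)) (mulr_ge0 (ltW eps0) (ler0n _ _)) eA eB.
  move: eAB h_ge.
  set a := #|A|%:R; set b := #|B|%:R; set a' := #|_|%:R; set b' := #|_|%:R.
  set e := (edges f A B)%:R; set z := h c d => eAB h_ge ab.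
  have ab0 : 0 <= a * b by rewrite mulr_ge0 ?ler0n.
  have h1 : 2 * eta * (a * b) <= z * (a * b) by apply: ler_wpM2r.
  have h2 : eta * (e - z * (a * b)) <= eta * (- eta * (a * b)).
    by apply: ler_wpM2l; [lra | lra].
  have h3 : eta ^+ 2 * (eps * a' * (eps * b')) <= eta ^+ 2 * (a * b).
    by apply: ler_wpM2l => //; apply: sqr_ge0.
  lra.
rewrite -ltNge => h_lt eAB.
exists (cell phi c, cell phi d, eta); split => //=.
move: eAB h_lt; set a := #|_|%:R; set b := #|_|%:R.
set e := (edges f _ _)%:R; set z := h c d => eAB h_lt.
have ab0 : 0 <= a * b by rewrite mulr_ge0 ?ler0n.
have h1 : z * (a * b) <= 2 * eta * (a * b) by apply: ler_wpM2r => //; lra.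
have h2 : eta * (eta * (a * b)) <= eta * (e - z * (a * b)).
  by apply: ler_wpM2l; [lra | lra].
have h3 : eta ^+ 2 * (a * b) * eps ^+ 2 <= eta ^+ 2 * (a * b).
  apply: ler_piMr; first by rewrite mulr_ge0 ?sqr_ge0.
  by apply: exprn_ile1 => //; apply: ltW.
lra.
Qed.

(* Changing [h] by [-eta] on the witness rectangles of irregular pairs, and by [eta]
   on pairs denser than predicted, decreases the squared error. *)
Lemma refine_sqerr (eps eta : R) (C : finType) (phi : X -> C) h :
  0 < eps -> eps <= 1 -> 0 < eta ->
  exists (phi' : X -> C * {ffun C -> bool * bool}) h',
    sqerr phi' h' <=
    sqerr phi h - eta ^+ 2 * eps ^+ 2 * misfit_mass eps eta phi h.
Proof.
move=> eps0 eps1 eta0.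
have /choice[W HW] : forall cd : C * C, _ :=
  fun cd => misfit_witness phi h cd.1 cd.2 eps0 eps1 eta0.
pose WA c d := (W (c, d)).1.1; pose WB c d := (W (c, d)).1.2.
pose s c d := (W (c, d)).2.
(* Two bits per old cell [d]: membership in the row side of the witness of [(phi x, d)] and in the
   column side of that of [(d, phi x)]. The new cells thus determine every witness rectangle. *)
exists (fun x => (phi x, [ffun d => (x \in WA (phi x) d, x \in WB d (phi x))])).
exists (fun c d : C * {ffun C -> bool * bool} => h c.1 d.1 + s c.1 d.1 *+ ((c.2 d.1).1 && (d.2 c.1).2)).
pose G x y := if (x \in WA (phi x) (phi y)) && (y \in WB (phi x) (phi y)) then
  s (phi x) (phi y) ^+ 2 - 2 * s (phi x) (phi y) * ((f x y)%:R - h (phi x) (phi y))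
  else 0.
rewrite /sqerr /=.
rewrite (_ : \sum_x _ = \sum_x \sum_y ((f x y)%:R - h (phi x) (phi y)) ^+ 2
                      + \sum_x \sum_y G x y); last first.
  rewrite -big_split /=; apply: eq_bigr => x _.
  rewrite -big_split /=; apply: eq_bigr => y _.
  rewrite !ffunE /= /G; case: ifP => _ /=; last by rewrite mulr0n !addr0.
  by rewrite mulr1n; ring.
rewrite lerD2l (sum_cells phi) /misfit_mass mulr_sumr -sumrN.
apply: ler_sum => c _; rewrite mulr_sumr [X in - X]big_mkcond -sumrN.
apply: ler_sum => d _; have [sA sB] := HW (c, d).
apply: le_trans; rewrite -sum_shift -/(WA c d) -/(WB c d) /=.
rewrite le_eqVlt; apply/orP; left; apply/eqP.
rewrite [LHS]big_mkcond [RHS]big_mkcond /=; apply: eq_bigr => x _.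
have [xc|xNc] := boolP (x \in cell phi c); last first.
  by have -> : (x \in WA c d) = false by apply: contraNF xNc => /(subsetP sA).
have [xA|xNA] := boolP (x \in WA c d); last first.
  apply: big1 => y; rewrite /G !inE in xc * => /eqP->.
  by rewrite (eqP xc) (negPf xNA).
rewrite [LHS]big_mkcond [RHS]big_mkcond /=; apply: eq_bigr => y _.
have [yd|yNd] := boolP (y \in cell phi d); last first.
  by have -> : (y \in WB c d) = false by apply: contraNF yNd => /(subsetP sB).
by move: xc yd; rewrite /G !inE => /eqP-> /eqP->; rewrite xA.
Qed.

Definition refined_size (c : nat) : nat := (c * 4 ^ c)%N.

Lemma card_refined (C : finType) :
  #|{: C * {ffun C -> bool * bool}}| = refined_size #|C|.
Proof. by rewrite card_prod card_ffun card_prod card_bool. Qed.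

Lemma refined_size_leq T c : (c <= iter T refined_size c)%N.
Proof.
elim: T => //= T /leq_trans; apply; rewrite /refined_size.
by rewrite leq_pmulr // expn_gt0.
Qed.

(** While the misfit mass is too large, a refinement lowers the squared error by more than a fixed
    amount; the error stays nonnegative, so at most [T] refinements occur. *)
Lemma exists_fitted_partition (eps eta gamma : R) T (C : finType) (phi : X -> C) h :
  0 < eps -> eps <= 1 -> 0 < eta -> 0 <= gamma ->
  sqerr phi h <= T%:R * (eta ^+ 2 * eps ^+ 2 * gamma * #|X|%:R ^+ 2) ->
  exists (C' : finType) (phi' : X -> C') (h' : C' -> C' -> R),
    (#|C'| <= iter T refined_size #|C|)%N /\
    misfit_mass eps eta phi' h' <= gamma * #|X|%:R ^+ 2.
Proof.
move=> eps0 eps1 eta0 gamma0; elim: T C phi h => [|T IH] C phi h hT.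
all: have [mle|mgt] := leP (misfit_mass eps eta phi h) (gamma * #|X|%:R ^+ 2);
  first by exists C, phi, h; rewrite refined_size_leq.
all: have [phi' [h' err']] := refine_sqerr phi h eps0 eps1 eta0.
all: have e2 : 0 < eta ^+ 2 * eps ^+ 2 by rewrite mulr_gt0 ?exprn_gt0.
all: have lt_mass : eta ^+ 2 * eps ^+ 2 * (gamma * #|X|%:R ^+ 2) <
    eta ^+ 2 * eps ^+ 2 * misfit_mass eps eta phi h by rewrite ltr_pM2l.
all: have drop0 : 0 <= eta ^+ 2 * eps ^+ 2 * (gamma * #|X|%:R ^+ 2)
  by apply: mulr_ge0; [exact: ltW | rewrite mulr_ge0 ?sqr_ge0].
  by move: hT; rewrite mul0r; have := sqerr_ge0 phi' h'; lra.
have [|C' [phi2 [h2 [cC' m2]]]] := IH _ phi' h'.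
  by move: hT; rewrite -natr1; lra.
exists C', phi2, h2; split => //.
by rewrite iterSr -card_refined.
Qed.

End Regularity.

Lemma exists_nat_gt (R : archiRealFieldType) (x : R) : exists n : nat, x < n%:R.
Proof.
exists (Num.bound `|x|).
exact: le_lt_trans (ler_norm x) (archi_boundP (normr_ge0 x)).
Qed.

Lemma regularity (R : archiRealFieldType) (eps eta gamma : R) :
  0 < eps -> eps <= 1 -> 0 < eta -> 0 < gamma ->
  exists M : nat, forall (X : finType) (f : rel X),
    exists (C : finType) (phi : X -> C) (F : rel C),
      [/\ (#|C| <= M)%N,
          forall c d, F c d -> lower_regular f eps eta (cell phi c) (cell phi d) &
          #|[set z : X * X | f z.1 z.2 && ~~ F (phi z.1) (phi z.2)]|%:R
            <= (3 * eta + gamma) * #|X|%:R ^+ 2].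
Proof.
move=> eps0 eps1 eta0 gamma0.
have k0 : 0 < eta ^+ 2 * eps ^+ 2 * gamma by rewrite !mulr_gt0.
(* The start is the one-cell partition with prediction 0, of error at most [#|X|%:R ^+ 2]; [T]
   decrements exhaust it. *)
have [T HT] := exists_nat_gt (eta ^+ 2 * eps ^+ 2 * gamma)^-1.
exists (iter T refined_size 1%N) => X f.
have [|C [phi [h [cC mass]]]] := @exists_fitted_partition R X f eps eta gamma T
    unit (fun=> tt) (fun _ _ => 0) eps0 eps1 eta0 (ltW gamma0).
  have err1 : sqerr f (fun=> tt) (fun _ _ => 0) <= #|X|%:R ^+ 2 :> R.
    apply: (@le_trans _ _ (\sum_(x : X) \sum_(y : X) 1)).
      apply: ler_sum => x _; apply: ler_sum => y _; rewrite subr0.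
      by case: (f x y); rewrite ?expr1n // expr0n.
    under eq_bigr do rewrite sumr_const.
    by rewrite sumr_const -[X in X <= _]mulr_natr expr2 lexx.
  apply: (le_trans err1); rewrite mulrA ler_peMl ?exprn_ge0 //.
  by move: HT; rewrite -(ltr_pM2r k0) mulVf ?gt_eqF // => /ltW.
(* An edge outside [F] lies in a misfit pair, paid for by [gamma], or in a pair of density below
   [3 * eta]. *)
pose F c d :=
  (2 * eta <= h c d) && lower_regular f eps eta (cell phi c) (cell phi d).
exists C, phi, F.
split=> [|c d /andP[]//|]; first by rewrite -[1%N]card_unit.
rewrite mulrDl.
have -> : #|[set z : X * X | f z.1 z.2 && ~~ F (phi z.1) (phi z.2)]|%:R =
    \sum_x \sum_y (f x y && ~~ F (phi x) (phi y))%:R :> R.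
  rewrite pair_big /= -sum1_card natr_sum big_mkcond; apply: eq_bigr => -[x y] _.
  by rewrite inE /=; case: (_ && _).
have -> : 3 * eta * #|X|%:R ^+ 2 = \sum_(c : C) \sum_(d : C)
    3 * eta * (#|cell phi c|%:R * #|cell phi d|%:R).
  have cX : #|X|%:R = \sum_c #|cell phi c|%:R :> R.
    rewrite -natr_sum -sum1_card (partition_big phi predT) //=; congr (_%:R).
    by apply: eq_bigr => c _; rewrite -sum1_card; apply: eq_bigl => x; rewrite inE.
  rewrite expr2 cX mulr_suml mulr_sumr; apply: eq_bigr => c _.
  by rewrite mulr_sumr mulr_sumr.
apply: (le_trans _ (lerD (lexx _) mass)).
rewrite (sum_cells phi) /misfit_mass -big_split; apply: ler_sum => c _ /=.
rewrite [X in _ <= _ + X]big_mkcond -big_split; apply: ler_sum => d _ /=.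
have edgesE : \sum_(x in cell phi c) \sum_(y in cell phi d) (f x y)%:R =
   (edges f (cell phi c) (cell phi d))%:R :> R.
  by rewrite natr_sum; apply: eq_bigr => x _; rewrite natr_sum.
have cc0 : 0 <= #|cell phi c|%:R * #|cell phi d|%:R :> R by rewrite mulr_ge0.
have sumE (b : bool) : (forall x y, x \in cell phi c -> y \in cell phi d ->
     f x y && ~~ F (phi x) (phi y) = f x y && b) ->
   \sum_(x in cell phi c) \sum_(y in cell phi d) (f x y && ~~ F (phi x) (phi y))%:R =
   \sum_(x in cell phi c) \sum_(y in cell phi d) (f x y && b)%:R :> R.
  by move=> Hb; apply: eq_bigr => x xc; apply: eq_bigr => y yd; rewrite Hb.
have Fcd x y : x \in cell phi c -> y \in cell phi d -> F (phi x) (phi y) = F c d.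
  by rewrite !inE => /eqP-> /eqP->.
rewrite (sumE (~~ F c d)); last by move=> x y xc yd; rewrite Fcd.
have sum_le : \sum_(x in cell phi c) \sum_(y in cell phi d) (f x y && ~~ F c d)%:R
    <= #|cell phi c|%:R * #|cell phi d|%:R :> R.
  apply: (@le_trans _ _ (\sum_(x in cell phi c) \sum_(y in cell phi d) 1)).
    by apply: ler_sum => x _; apply: ler_sum => y _; case: (_ && _).
  by under eq_bigr do rewrite sumr_const; rewrite sumr_const -[X in X <= _]mulr_natr mulrC lexx.
case: ifPn => [_|]; first by rewrite (le_trans sum_le) // lerDr !mulr_ge0 // ltW.
rewrite addr0 /misfit; case: ifPn => [hge|].
  rewrite negbK => reg; rewrite [X in X <= _]big1 ?mulr_ge0 //; first exact: ltW.
  move=> x _; apply: big1 => y _.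
  by rewrite /F hge reg andbF.
rewrite -ltNge => hlt; rewrite -ltNge => e_lt.
have -> : F c d = false by rewrite /F leNgt hlt.
under eq_bigr do under eq_bigr do rewrite andbT.
by rewrite edgesE ltW.
Qed.

(** * Cliques in general position in dense linear spaces *)

Lemma exists_avoiding (X : finType) (U : {set X}) (Bs : seq {set X}) :
  (\sum_(B <- Bs) #|B| < #|U|)%N ->
  exists2 u, u \in U & forall B, B \in Bs -> u \notin B.
Proof.
elim: Bs U => [|B Bs IH] U.
  by rewrite big_nil card_gt0 => /set0Pn[u uU]; exists u.
rewrite big_cons => lt_U; have [|u] := IH (U :\: B).
  rewrite -(ltn_add2l #|B|); apply: leq_trans lt_U _.
  by rewrite -(cardsID B U) leq_add2r subset_leq_card // subsetIr.
rewrite !inE => /andP[uNB uU] uBs; exists u => // B'.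
by rewrite inE => /predU1P[->//|/uBs].
Qed.

(** * Greedy choice of a clique in pairwise regular classes *)

Section Greedy.
Variables (R : realFieldType) (X : finType) (f : rel X) (col : X -> X -> X -> bool).

Fixpoint generic_clique (W : seq X) : bool :=
  if W is u :: V then
    [&& all (f u) V, all (fun v => all (fun w => (v == w) || ~~ col u v w) V) V
      & generic_clique V]
  else true.

Hypothesis f_sym : symmetric f.

Lemma generic_clique_adj W : generic_clique W ->
  {in W &, forall v w, v != w -> f v w}.
Proof.
elim: W => //= u V IH /and3P[/allP fu _ /IH{}IH] v w.
rewrite !inE => /predU1P[->|vV] /predU1P[->|wV]; rewrite ?eqxx //.
- by move=> _; apply: fu.
- by move=> _; rewrite f_sym; apply: fu.
- exact: IH.
Qed.

(** Otherwise the low-degree vertices and [W] would span a large rectangle of density below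
    [eta]. *)
Lemma few_low_degree (eps eta : R) (A B U W : {set X}) :
  0 <= eps -> lower_regular f eps eta A B -> U \subset A -> W \subset B ->
  eps * #|B|%:R <= #|W|%:R ->
  #|[set u in U | #|[set y in W | f u y]|%:R < eta * #|W|%:R]|%:R
    <= eps * #|A|%:R.
Proof.
move=> eps0 /forallP reg UA WB epsW; set D := [set u in U | _].
rewrite leNgt; apply/negP => ltD.
have /forallP/(_ W) := reg D; rewrite WB (ltW ltD) epsW !andbT.
rewrite (subset_trans _ UA) /=; last by apply/subsetP => u; rewrite inE => /andP[].
apply/negP; rewrite -ltNge /edges natr_sum.
have Dn0 : D != set0.
  rewrite -card_gt0 -(ltr0n R); apply: le_lt_trans ltD.
  by rewrite mulr_ge0 ?ler0n.
apply: (@lt_le_trans _ _ (\sum_(u in D) eta * #|W|%:R)); last first.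
  by rewrite sumr_const -mulr_natr; lra.
apply: ltr_sum; first by have /set0Pn[u uD] := Dn0; apply/hasP; exists u; rewrite ?mem_index_enum.
move=> u; rewrite inE => /andP[_]; apply: le_lt_trans.
rewrite ler_nat -sum1_card big_mkcond [leqRHS]big_mkcond /=.
by apply: leq_sum => y _; rewrite inE; case: (y \in W); case: (f u y).
Qed.

Variables (eps eta beta : R) (k : nat).
Hypotheses (eps_ge0 : 0 <= eps) (eta_gt0 : 0 < eta) (eta_le1 : eta <= 1).
Hypotheses (beta_ge0 : 0 <= beta).
Hypothesis few_col : forall v w, v != w -> f v w ->
  #|[set u | col u v w]|%:R <= beta.

(** An entry of [us] is a class still to be used with its remaining candidates, all joined to the
    chosen points [V]. A new point keeps a proportion [eta] of each later candidate set. The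
    numerical hypothesis leaves a candidate after discarding the low-degree vertices for each later
    class and at most [beta] points for each pair in [V]. *)
Lemma extend_generic_clique n (us : seq ({set X} * {set X})) (V : seq X) :
  size us = n -> (size V + n = k)%N ->
  pairwise (fun a b => lower_regular f eps eta a.1 b.1) us ->
  (forall a, a \in us -> [/\ a.2 \subset a.1,
     eta ^+ (size V) * #|a.1|%:R <= #|a.2|%:R &
     k%:R * (eps * #|a.1|%:R) + (k ^ 2)%:R * beta < eta ^+ k * #|a.1|%:R]) ->
  (forall a x, a \in us -> x \in a.2 -> all (f x) V) ->
  generic_clique V ->
  exists2 W, size W = k & generic_clique W.
Proof.
elim: n us V => [|n IH] [|[A U] us] V //=.
  by move=> _; rewrite addn0 => <- _ _ _ clV; exists V.
move=> [sz_us] sz_k /andP[/allP regA reg] Hus fV clV.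
have k_gt0 : (0 < k)%N by rewrite -sz_k addnS.
have leVk : (size V <= k)%N by rewrite -sz_k leq_addr.
have etak : eta ^+ k <= eta ^+ (size V) by rewrite ler_wiXn2l // ltW.
have eps_small a : a \in (A, U) :: us -> eps * #|a.1|%:R <= #|a.2|%:R.
  move=> /Hus[_ h1 h2]; apply: le_trans h1.
  apply: (@le_trans _ _ (eta ^+ k * #|a.1|%:R)); last by rewrite ler_wpM2r.
  apply: le_trans (ltW h2); rewrite -[leLHS]addr0 lerD ?mulr_ge0 //.
  by rewrite ler_peMl ?mulr_ge0 // ler1n.
have [UA szU ltA] := Hus (A, U) (mem_head _ _); rewrite /= in UA szU ltA.
pose low (a : {set X} * {set X}) := [set u in U | #|[set y in a.2 | f u y]|%:R < eta * #|a.2|%:R].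
(* The bound [few_col] covers distinct points only, hence the empty set on the diagonal. *)
pose span (v w : X) := if v == w then set0 else [set u | col u v w].
have [|u uU uB] := @exists_avoiding X U
    ([seq low a | a <- us] ++ [seq span v w | v <- V, w <- V]).
  rewrite -(ltr_nat R) big_cat natrD /=.
  apply: lt_le_trans (le_trans (ler_wpM2r _ etak) szU); last exact: ler0n.
  apply: le_lt_trans ltA; apply: lerD.
    rewrite big_map natr_sum big_seq.
    apply: (@le_trans _ _ (\sum_(a <- us | a \in us) eps * #|A|%:R)).
      apply: ler_sum => a aus; apply: few_low_degree (eps_small a _) => //.
      - exact: regA.
      - by have [] := Hus a; rewrite ?inE ?aus ?orbT.
      - by rewrite inE aus orbT.
    rewrite -big_seq big_const_seq count_predT iter_addr_0 -[leLHS]mulr_natl.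
    by rewrite ler_wpM2r ?mulr_ge0 // ler_nat sz_us -sz_k; lia.
  rewrite big_allpairs_dep natr_sum big_seq.
  apply: (@le_trans _ _ (\sum_(v <- V | v \in V) k%:R * beta)).
    apply: ler_sum => v vV; rewrite natr_sum big_seq.
    apply: (@le_trans _ _ (\sum_(w <- V | w \in V) beta)).
      apply: ler_sum => w wV; rewrite /span; case: eqVneq => [_|vw].
        by rewrite cards0.
      by apply: few_col => //; apply: generic_clique_adj clV _ _ _ _ _.
    rewrite -big_seq big_const_seq count_predT iter_addr_0 -[leLHS]mulr_natl.
    by rewrite ler_wpM2r // ler_nat.
  rewrite -big_seq big_const_seq count_predT iter_addr_0 -[leLHS]mulr_natl.
  by rewrite expnS expn1 natrM -mulrA ler_wpM2r ?mulr_ge0 // ler_nat.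
pose cut (a : {set X} * {set X}) : {set X} * {set X} := (a.1, [set y in a.2 | f u y]).
apply: (IH (map cut us) (u :: V)); rewrite ?size_map //=.
- by rewrite -sz_k addnS.
- by rewrite pairwise_map.
- move=> _ /mapP[a aus ->]; have aus' : a \in (A, U) :: us by rewrite inE aus orbT.
  have [sa szb lta] := Hus a aus'; split=> //=.
    by apply: subset_trans sa; apply/subsetP => y; rewrite inE => /andP[].
  have : u \notin low a by apply: uB; rewrite mem_cat map_f.
  rewrite inE uU /= -leNgt; apply: le_trans.
  by rewrite exprS -mulrA ler_wpM2l // ltW.
- move=> _ y /mapP[a aus ->]; rewrite inE => /andP[ya fuy]; rewrite /= f_sym fuy /=.
  by apply: (fV a) => //; rewrite inE aus orbT.
- rewrite clV andbT (fV (A, U)) ?mem_head //=.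
  apply/allP => v vV; apply/allP => w wV.
  have : u \notin span v w by apply: uB; rewrite mem_cat allpairs_f ?orbT.
  by rewrite /span; case: eqVneq => //=; rewrite inE.
Qed.

End Greedy.

(** * Partial linear spaces *)

Section LinearSpace.
Variables (X I : finType) (inc : X -> I -> bool).

Definition points_on (i : I) : {set X} := [set x | inc x i].

Definition partial_linear : Prop :=
  forall x y i j, x != y -> inc x i -> inc y i -> inc x j -> inc y j -> i = j.

Definition pairs_on (B : {set X * X}) (i : I) : {set X * X} :=
  [set z in B | [&& z.1 != z.2, inc z.1 i & inc z.2 i]].

(** Two distinct points determine their line, so the sets [pairs_on B i] are disjoint. *)
Lemma sum_pairs_on (B : {set X * X}) : partial_linear ->
  (\sum_i #|pairs_on B i| <= #|B|)%N.
Proof.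
move=> lin; rewrite -[leqRHS]sum1_card.
under eq_bigr => i _ do rewrite -sum1_card.
rewrite (exchange_big_dep (mem B)) /=; last by move=> i z _; rewrite inE => /andP[].
apply: leq_sum => z zB; rewrite sum1_card.
apply/card_le1_eqP => i j zi zj.
have {zi} : z \in pairs_on B i := zi; have {zj} : z \in pairs_on B j := zj.
rewrite !inE => /and4P[_ z12 j1 j2] /and4P[_ _ i1 i2]; exact: (lin z.1 z.2).
Qed.

Lemma card_pairs_on i :
  (#|points_on i| ^ 2 <= #|pairs_on setT i| + #|points_on i|)%N.
Proof.
rewrite expnS expn1 -cardsX.
apply: (@leq_trans #|pairs_on setT i :|: [set (x, x) | x in points_on i]|).
  apply/subset_leq_card/subsetP => -[x y]; rewrite !inE /= => /andP[xi yi].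
  case: eqVneq => [->|_] /=; last by rewrite xi yi.
  by apply/imsetP; exists y; rewrite ?inE.
by apply: leq_trans (leq_card_setU _ _) _; rewrite leq_add2l leq_imset_card.
Qed.

(** For [t >= 2] one has [t ^ 2 <= 2 * (t ^ 2 - t)], and [t ^ 2 - t] counts ordered pairs on a
    line. *)
Lemma sum_card_points_on_sqr : partial_linear ->
  (\sum_(i | 1 < #|points_on i|) #|points_on i| ^ 2 <= 2 * #|X| ^ 2)%N.
Proof.
move=> lin; apply: (@leq_trans (2 * \sum_i #|pairs_on setT i|)).
  rewrite big_distrr /= big_mkcond; apply: leq_sum => i _.
  case: ifP => // ti; have := card_pairs_on i.
  have : (2 * #|points_on i| <= #|points_on i| ^ 2)%N.
    by rewrite expnS expn1 leq_mul2r ti orbT.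
  by move: (#|points_on i| ^ 2)%N #|pairs_on _ i| #|points_on i| => a b d; lia.
by rewrite leq_mul2l /= (leq_trans (sum_pairs_on _ lin)) // cardsT card_prod expnS expn1.
Qed.

End LinearSpace.

Lemma sum_small_cells (R : realFieldType) (X C : finType) (phi : X -> C) (a : R) :
  0 <= a -> #|[set x | #|cell phi (phi x)|%:R < a]|%:R <= #|C|%:R * a.
Proof.
move=> a0; rewrite -sum1_card natr_sum (partition_big phi predT) //=.
apply: (@le_trans _ _ (\sum_(c : C) a)); last by rewrite sumr_const mulr_natl lexx.
apply: ler_sum => c _; rewrite -natr_sum sum1_card.
have [lt_c|ge_c] := ltP #|cell phi c|%:R a.
  apply: le_trans (ltW lt_c); rewrite ler_nat; apply/subset_leq_card/subsetP => x.
  by rewrite !inE => /andP[].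
rewrite eq_card0 // => x; rewrite !inE; apply/negP => /andP[+ /eqP xc].
by rewrite inE xc ltNge ge_c.
Qed.

Lemma generic_clique_not_col (X : finType) (f : rel X) (col : X -> X -> X -> bool) W :
  (forall x y z, col x y z -> col y x z) -> (forall x y z, col x y z -> col x z y) ->
  generic_clique f col W ->
  {in W & &, forall x y z, x != y -> x != z -> y != z -> ~~ col x y z}.
Proof.
move=> c1 c2; elim: W => //= u V IH /and3P[_ /allP cu /IH{}IH] x y z.
have colu v w : v \in V -> w \in V -> v != w -> ~~ col u v w.
  by move=> /cu /allP cv /cv; case: eqVneq.
rewrite !inE => /predU1P[->|xV] /predU1P[->|yV] /predU1P[->|zV]; rewrite ?eqxx //.
- by move=> _ _; apply: colu.
- by move=> _ xz _; apply: contra (colu _ _ xV zV xz) => /c1.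
- by move=> xy _ _; apply: contra (colu _ _ xV yV xy) => /c2/c1.
- exact: IH.
Qed.

Lemma generic_clique_uniq (X : finType) (f : rel X) col W :
  irreflexive f -> generic_clique f col W -> uniq W.
Proof.
move=> f_irr; elim: W => //= u V IH /and3P[/allP fu _ /IH->]; rewrite andbT.
by apply/negP => /fu; rewrite f_irr.
Qed.

Lemma linear_space_generic_clique (R : archiRealFieldType) (k : nat) (c : R) :
  (0 < k)%N -> 0 < c ->
  exists m0 : nat, forall (X I : finType) (inc : X -> I -> bool),
    partial_linear inc -> (m0 <= #|X|)%N ->
    c * #|X|%:R ^+ 2 <=
      (\sum_(i | 2 * k <= #|points_on inc i|) #|points_on inc i|)%N%:R ->
    exists W : seq X,
      [/\ uniq W, size W = k,
          {in W &, forall x y, x != y -> exists i, inc x i && inc y i} &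
          {in W & &, forall x y z, x != y -> x != z -> y != z ->
             forall i, ~~ [&& inc x i, inc y i & inc z i]}].
Proof.
move=> k_gt0 c_gt0; have k0 : 0 < k%:R :> R by rewrite ltr0n.
(* With 48, twice the number of uncontrolled pairs, at most [20 * eta * m ^+ 2], stays below the
   [c / 2 * m ^+ 2] incidences kept on light lines. *)
pose eta : R := Num.min c 1 / 48.
have min_gt0 : 0 < Num.min c 1 by rewrite lt_min c_gt0 ltr01.
have min_lec : Num.min c 1 <= c by rewrite ge_min lexx.
have min_le1 : Num.min c 1 <= 1 by rewrite ge_min lexx orbT.
have eta_gt0 : 0 < eta by rewrite /eta; lra.
have eta_le1 : eta <= 1 by rewrite /eta; lra.
have etak_gt0 : 0 < eta ^+ k by rewrite exprn_gt0.
have etak_le1 : eta ^+ k <= 1 by rewrite exprn_ile1 // ltW.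
(* Low-degree vertices for [k] classes use up half of the budget [eta ^+ k]. *)
pose eps : R := eta ^+ k / (2 * k%:R).
have eps_gt0 : 0 < eps by rewrite divr_gt0 // mulr_gt0.
have epsE : k%:R * eps = eta ^+ k / 2 by rewrite /eps; field; rewrite gt_eqF.
have eps_le1 : eps <= 1.
  have : eps <= k%:R * eps by apply: ler_peMl; rewrite ?ler1n // ltW.
  by rewrite epsE; lra.
have [M HM] := regularity eps_gt0 eps_le1 eta_gt0 eta_gt0.
have M_gt0 : 0 < M.+1%:R :> R by rewrite ltr0n.
(* At most [M] cells are smaller than [mu * m], so together these hold at most [eta * m] points. *)
pose mu : R := eta / M.+1%:R.
have mu_gt0 : 0 < mu by rewrite divr_gt0.
(* For a class of at least [mu * m] points, [k ^ 2] lines of [eps0 * m] points use up at most a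
   quarter of the budget. *)
pose eps0 : R := mu * eta ^+ k / (4 * (k ^ 2)%:R).
have k2_gt0 : 0 < (k ^ 2)%:R :> R by rewrite ltr0n expn_gt0 k_gt0.
have eps0_gt0 : 0 < eps0 by rewrite divr_gt0 // mulr_gt0.
have eps0E : (k ^ 2)%:R * eps0 = mu * eta ^+ k / 4.
  by rewrite /eps0; field; rewrite gt_eqF.
have [m0 Hm0] := exists_nat_gt (4 / (eps0 * c)).
exists m0.+1 => X I inc lin m_ge Hsum.
pose m : R := #|X|%:R; pose t i := #|points_on inc i|.
have m_gt0 : 0 < m by rewrite ltr0n; apply: leq_trans m_ge.
have m_big : 4 <= eps0 * c * m.
  have ec0 : 0 < eps0 * c by rewrite mulr_gt0.
  rewrite [leRHS]mulrC -ler_pdivrMr //.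
  by apply: le_trans (ltW Hm0) _; rewrite ler_nat ltnW.
pose beta := eps0 * m; have beta_gt0 : 0 < beta by rewrite mulr_gt0.
pose light i := (t i)%:R <= beta.
(* On a heavy line [beta * t i <= t i ^ 2], and the squares sum to at most [2 * m ^+ 2]. *)
have heavy : (\sum_(i | (2 * k <= t i)%N && ~~ light i) t i)%N%:R <= c / 2 * m ^+ 2.
  have : beta * (\sum_(i | (2 * k <= t i)%N && ~~ light i) t i)%N%:R <= 2 * m ^+ 2.
    apply: (@le_trans _ _ (2 * #|X| ^ 2)%N%:R); last by rewrite natrM natrX.
    apply: le_trans _ (_ : (\sum_(i | (1 < t i)%N) t i ^ 2)%N%:R <= _); last first.
      by rewrite ler_nat sum_card_points_on_sqr.
    rewrite !natr_sum mulr_sumr big_mkcond [leRHS]big_mkcond.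
    apply: ler_sum => i _; case: ifPn => [/andP[ti]|_]; last by case: ifP.
    rewrite /light -ltNge => lt_t; rewrite (leq_trans (leq_pmulr 2 k_gt0) ti).
    by rewrite natrX expr2 ler_wpM2r // ltW.
  set s := (\sum_(i | _) _)%N%:R => hs.
  rewrite -(ler_pM2l beta_gt0); apply: le_trans hs _; rewrite /beta.
  have -> : eps0 * m * (c / 2 * m ^+ 2) = eps0 * c * m * (m ^+ 2 / 2) by ring.
  have : 4 * (m ^+ 2 / 2) <= eps0 * c * m * (m ^+ 2 / 2).
    by apply: ler_wpM2r => //; have := sqr_ge0 m; lra.
  lra.
have lightS : c / 2 * m ^+ 2 <= (\sum_(i | (2 * k <= t i)%N && light i) t i)%N%:R.
  by move: Hsum; rewrite (bigID light) /= natrD -/m; lra.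
pose f : rel X := fun x y =>
  (x != y) && [exists i, [&& light i, inc x i & inc y i]].
have f_sym : symmetric f.
  move=> x y; rewrite /f eq_sym; congr (_ && _); apply: eq_existsb => i.
  by case: (light i) => //=; rewrite andbC.
have f_irr : irreflexive f by move=> x; rewrite /f eqxx.
have [C [phi [F [cC Freg Fbad]]]] := HM X f.
pose big x := mu * m <= #|cell phi (phi x)|%:R.
pose ok x y := [&& F (phi x) (phi y), F (phi y) (phi x), big x & big y].
pose bad := [set z : X * X | f z.1 z.2 && ~~ ok z.1 z.2].
(* Each orientation of [F] costs [4 * eta * m ^+ 2], and a small cell in either coordinate costs
   [eta * m ^+ 2]. *)
have bad_small : #|bad|%:R <= 10 * eta * m ^+ 2.
  pose b1 := [set z : X * X | f z.1 z.2 && ~~ F (phi z.1) (phi z.2)].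
  pose small := [set x | #|cell phi (phi x)|%:R < mu * m].
  pose sw (z : X * X) := (z.2, z.1).
  have bad_sub : bad \subset (b1 :|: [set sw z | z in b1])
      :|: (setX small setT :|: setX setT small).
    apply/subsetP => -[x y]; rewrite !inE /= andbT => /andP[fxy].
    rewrite fxy /ok !negb_and /big -!ltNge => /or4P[->//|Fyx|->|->]; rewrite ?orbT //.
    apply/orP; left; apply/orP; right; apply/imsetP; exists (y, x) => //.
    by rewrite inE /= f_sym fxy.
  have small_le : #|small|%:R <= eta * m.
    apply: le_trans (sum_small_cells phi (ltW (mulr_gt0 mu_gt0 m_gt0))) _.
    rewrite mulrA; apply: ler_wpM2r; first exact: ltW.
    rewrite /mu mulrCA; apply: ler_piMr; first exact: ltW.
    by rewrite ler_pdivrMr // mul1r ler_nat leqW.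
  have : (#|bad| <= (#|b1| + #|b1|) + (#|small| * #|X| + #|X| * #|small|))%N.
    apply: leq_trans (subset_leq_card bad_sub) _.
    apply: leq_trans (leq_card_setU _ _) _; apply: leq_add.
      by apply: leq_trans (leq_card_setU _ _) _; rewrite leq_add2l leq_imset_card.
    by apply: leq_trans (leq_card_setU _ _) _; rewrite !cardsX cardsT.
  rewrite -(ler_nat R) !natrD !natrM -/m => /le_trans; apply.
  have : #|small|%:R * m <= eta * m * m by rewrite ler_wpM2r // ltW.
  by move: Fbad; rewrite -/m -/b1; lra.
pose good i x := inc x i && [forall y, (y != x) && inc y i ==> ok x y].
have [/existsP[i /and3P[ti li gi]]|/existsPn Hno] :=
  boolP [exists i, [&& (2 * k <= t i)%N, light i & (k <= #|[set x | good i x]|)%N]];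
  last first.
  exfalso.
  have : (\sum_(i | (2 * k <= t i)%N && light i) t i <= 2 * #|bad|)%N.
    apply: leq_trans _ (_ : 2 * \sum_i #|pairs_on inc bad i| <= _)%N; last first.
      by rewrite leq_mul2l sum_pairs_on.
    rewrite big_distrr /= big_mkcond; apply: leq_sum => i _.
    case: ifP => // /andP[ti li]; have := Hno i; rewrite ti li /= -ltnNge => lt_k.
    (* A point that is not good starts a bad pair on its line; with fewer than [k] good points among
       at least [2 * k], at least half of the points do so. *)
    have leD : (#|points_on inc i :\: [set x | good i x]| <= #|pairs_on inc bad i|)%N.
      apply: leq_trans (leq_imset_card fst _).
      apply/subset_leq_card/subsetP => x; rewrite !inE /good => /andP[+ xi].
      rewrite xi /= => /forallPn[y]; rewrite negb_imply => /andP[/andP[yx yi] nok].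
      apply/imsetP; exists (x, y) => //; rewrite !inE /= nok xi yi eq_sym yx /= !andbT.
      by rewrite /f eq_sym yx; apply/existsP; exists i; rewrite li xi yi.
    have leI := subset_leq_card (subsetIr (points_on inc i) [set x | good i x]).
    have eqt := cardsID [set x | good i x] (points_on inc i).
    have arith a d g e p : (d <= p -> a <= g -> g < k -> 2 * k <= e -> a + d = e ->
      e <= 2 * p)%N by clear; lia.
    exact: arith leD leI lt_k ti eqt.
  rewrite -(ler_nat R) natrM => /(le_trans lightS).
  have m2 : 0 < m ^+ 2 by rewrite exprn_gt0.
  have : Num.min c 1 * m ^+ 2 <= c * m ^+ 2 by rewrite ler_wpM2r // ltW.
  have : 0 < Num.min c 1 * m ^+ 2 by rewrite mulr_gt0.
  by move: bad_small; rewrite /eta; lra.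
(* Two of these points may share a class; the pair of this class with itself is then controlled by
   [F] too. *)
pose xs := take k (enum [set x | good i x]).
have xs_size : size xs = k by rewrite size_takel // -cardE.
have xs_good x : x \in xs -> good i x by move=> /mem_take; rewrite mem_enum inE.
have xs_uniq : uniq xs by rewrite take_uniq // enum_uniq.
have xs_ok : {in xs &, forall x y, x != y -> ok x y}.
  move=> x y /xs_good/andP[xi /forallP/(_ y)] hx /xs_good/andP[yi _] xy.
  by move: hx; rewrite eq_sym xy yi.
have xs_big x : x \in xs -> big x.
  move=> /xs_good/andP[xi /forallP hx].
  have /card_gt0P[y] : (0 < #|points_on inc i :\ x|)%N.
    have := cardsD1 x (points_on inc i); rewrite inE xi /=.
    by move=> tE; move: (leq_trans (leq_pmulr 2 k_gt0) ti); rewrite /t tE.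
  by rewrite !inE => hy; have := hx y; rewrite hy => /and4P[].
pose col x y z := [exists i, [&& light i, inc x i, inc y i & inc z i]].
have few_col v w : v != w -> f v w -> #|[set u | col u v w]|%:R <= beta.
  move=> vw /andP[_ /existsP[j /and3P[lj vj wj]]]; apply: le_trans lj.
  rewrite ler_nat; apply/subset_leq_card/subsetP => u; rewrite !inE.
  move=> /existsP[j' /and4P[_ uj' vj' wj']].
  by rewrite (lin v w j j').
have [|||a|//|//|W szW clW] := @extend_generic_clique R X f col f_sym eps eta beta k
  (ltW eps_gt0) eta_gt0 eta_le1 (ltW beta_gt0) few_col k
  [seq (cell phi (phi x), cell phi (phi x)) | x <- xs] [::].
- by rewrite size_map.
- by [].
- rewrite pairwise_map; move: xs_uniq; rewrite uniq_pairwise.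
  apply: sub_in_pairwise (allss xs) => x y xxs yxs xy.
  by apply: Freg; have /and4P[] := xs_ok x y xxs yxs xy.
- move=> /mapP[z zxs ->] /=; split=> //; first by rewrite expr0 mul1r.
  have zbig := xs_big z zxs; rewrite /big in zbig.
  have z_gt0 : 0 < #|cell phi (phi z)|%:R :> R by apply: lt_le_trans zbig; rewrite mulr_gt0.
  rewrite mulrA epsE mulrA eps0E.
  have : eta ^+ k * (mu * m) <= eta ^+ k * #|cell phi (phi z)|%:R by rewrite ler_wpM2l // ltW.
  have : 0 < eta ^+ k * #|cell phi (phi z)|%:R by rewrite mulr_gt0.
  lra.
exists W; split=> //; first exact: generic_clique_uniq clW.
  move=> x y xW yW xy; have /andP[_ /existsP[j /and3P[_ xj yj]]] :=
    generic_clique_adj f_sym clW xW yW xy.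
  by exists j; rewrite xj yj.
move=> x y z xW yW zW xy xz yz j; apply/negP => /and3P[xj yj zj].
have /andP[_ /existsP[l /and3P[ll xl yl]]] := generic_clique_adj f_sym clW xW yW xy.
(* Although [col] sees light lines only, this is enough: any line through [x] and [y] is the light
   line joining them. *)
have : ~~ col x y z.
  apply: generic_clique_not_col clW _ _ _ xW yW zW xy xz yz.
    by move=> u v w /existsP[i0 /and4P[a1 a2 a3 a4]]; apply/existsP; exists i0; rewrite a1 a2 a3 a4.
  by move=> u v w /existsP[i0 /and4P[a1 a2 a3 a4]]; apply/existsP; exists i0; rewrite a1 a2 a3 a4.
by move=> /existsPn/(_ l); rewrite ll xl yl (lin x y l j) // zj.
Qed.

(** * Vertical decomposition of a sample of lines *)

Lemma card_le1_in (T : finType) (A : {set T}) :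
  {in A &, forall x y, x = y} -> (#|A| <= 1)%N.
Proof. by move=> eqA; apply/card_le1_eqP => x y xA yA; apply: eqA. Qed.

Lemma leq_card_imset_coded (T U V : finType) (Q : {set T}) (lab : T -> U) (code : T -> V) :
  {in Q &, forall q q', code q = code q' -> lab q = lab q'} ->
  (#|lab @: Q| <= #|code @: Q|)%N.
Proof.
move=> coded; have [->|/set0Pn[q0 q0Q]] := eqVneq Q set0.
  by rewrite imset0 cards0.
pose h v := if [pick q in Q | code q == v] is Some q then lab q else lab q0.
apply: leq_trans (leq_imset_card h _); apply/subset_leq_card/subsetP => _ /imsetP[q qQ ->].
apply/imsetP; exists (code q); first exact: imset_f.
rewrite /h; case: pickP => [q' /andP[q'Q /eqP cq]|/(_ q)]; last by rewrite qQ eqxx.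
exact: coded.
Qed.

(** * Sign changes of affine functions *)

Section AffineSigns.
Variable R : realFieldType.
Implicit Types a b x : R.

Lemma affine_neg_right a b x0 x1 x2 :
  0 <= a * x0 + b -> a * x1 + b < 0 -> x0 <= x1 -> x1 <= x2 -> a * x2 + b < 0.
Proof.
move=> g0 g1 x01 x12.
have a0 : a <= 0.
  rewrite leNgt; apply/negP => a_gt0.
  by have := ler_wpM2l (ltW a_gt0) x01; lra.
by have := ler_wnM2l a0 x12; lra.
Qed.

Lemma affine_neg_left a b x0 x1 x2 :
  0 <= a * x0 + b -> a * x1 + b < 0 -> x1 <= x0 -> x2 <= x1 -> a * x2 + b < 0.
Proof.
move=> g0 g1 x10 x21.
have := @affine_neg_right (- a) b (- x0) (- x1) (- x2).
by rewrite !mulrNN !lerN2; apply.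
Qed.

(** An affine function that has turned negative stays negative farther out, so the one negative at
    the nearer of [x1], [x2] is negative at the farther one as well. *)
Lemma no_mutual_crossing a1 b1 a2 b2 x0 x1 x2 :
  0 <= a1 * x0 + b1 -> 0 <= a2 * x0 + b2 ->
  a1 * x1 + b1 < 0 -> a2 * x2 + b2 < 0 ->
  0 <= a2 * x1 + b2 -> 0 <= a1 * x2 + b1 ->
  (x0 < x1) = (x0 < x2) -> False.
Proof.
move=> g10 g20 g11 g22 g21 g12.
case: (ltP x0 x1) => [/ltW x01|x10]; case: (ltP x0 x2) => [/ltW x02|x20] // _.
  have [x12|/ltW x21] := leP x1 x2.
    by have := affine_neg_right g10 g11 x01 x12; lra.
  by have := affine_neg_right g20 g22 x02 x21; lra.
have [x12|/ltW x21] := leP x1 x2.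
  by have := affine_neg_left g20 g22 x20 x12; lra.
by have := affine_neg_left g10 g11 x10 x21; lra.
Qed.

End AffineSigns.

Section Sampling.
Variables (R : realFieldType) (X I : finType) (px py : X -> R) (a b : I -> R).

Definition height (i : I) (x : R) : R := a i * x + b i.
Definition on_line (p : X) (i : I) : bool := py p == height i (px p).

Definition above (S : {set I}) p := [set i in S | py p < height i (px p)].
Definition below (S : {set I}) p := [set i in S | height i (px p) < py p].
Definition through (S : {set I}) p := [set i in S | on_line p i].
(** A set rather than an element, as it is empty when [A] is; genericity makes it at most a
    singleton for the lines above [p]. *)
Definition tops p (A : {set I}) :=
  [set t in A | [forall u in A, height t (px p) <= height u (px p)]].
Definition bots p (A : {set I}) :=
  [set t in A | [forall u in A, height u (px p) <= height t (px p)]].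

(* When no line of [S] passes through [p], this is the trapezoid of the vertical
   decomposition of [S] that contains [p]: by convexity of the cells of the
   arrangement it is determined by the sides of the lines and by the two lines
   next to [p] on its vertical line. *)
Definition trapezoid (S : {set I}) p : {set I} * {set I} * {set I} * {set I} :=
  (through S p, above S p, tops p (above S p), bots p (below S p)).

Definition free S p := through S p == set0.

(** Only points of [X] serve as witnesses: this suffices for counting incidences and keeps the
    geometry finite. *)
Definition meets (S : {set I}) (l : I) (p : X) : bool :=
  [exists q, [&& on_line q l, free S q & trapezoid S q == trapezoid S p]].

Definition met_trapezoids (S : {set I}) (l : I) :=
  [set trapezoid S q | q in [set q | on_line q l && free S q]].

Hypothesis generic_points : forall p i j,
  i != j -> height i (px p) = height j (px p) -> on_line p i.

Lemma tops_card_le1 S p : (#|tops p (above S p)| <= 1)%N.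
Proof.
apply: card_le1_in => i j; rewrite /tops !inE.
move=> /andP[/andP[iS pi] /forall_inP imin] /andP[/andP[jS pj] /forall_inP jmin].
apply/eqP/negPn/negP => ij.
have eq_ij : height i (px p) = height j (px p).
  by apply/eqP; rewrite eq_le imin ?jmin ?inE ?iS ?jS.
by move: pi; rewrite (eqP (generic_points ij eq_ij)) ltxx.
Qed.

Lemma bots_card_le1 S p : (#|bots p (below S p)| <= 1)%N.
Proof.
apply: card_le1_in => i j; rewrite /bots !inE.
move=> /andP[/andP[iS pi] /forall_inP imax] /andP[/andP[jS pj] /forall_inP jmax].
apply/eqP/negPn/negP => ij.
have eq_ij : height i (px p) = height j (px p).
  by apply/eqP; rewrite eq_le imax ?jmax ?inE ?iS ?jS.
by move: pi; rewrite (eqP (generic_points ij eq_ij)) ltxx.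
Qed.

Lemma tops_neq0 p (A : {set I}) i : i \in A -> exists t, t \in tops p A.
Proof.
move=> iA; case: (arg_minP (fun i => height i (px p)) iA) => t tA tmin.
by exists t; rewrite inE (tA : t \in A); apply/forall_inP.
Qed.

Lemma bots_neq0 p (A : {set I}) i : i \in A -> exists t, t \in bots p A.
Proof.
move=> iA; case: (arg_maxP (fun i => height i (px p)) iA) => t tA tmax.
by exists t; rewrite inE (tA : t \in A); apply/forall_inP.
Qed.

Lemma in_tops S p t : t \in tops p (above S p) ->
  [/\ t \in S, py p < height t (px p) &
      forall u, u \in above S p -> height t (px p) <= height u (px p)].
Proof. by rewrite !inE => /andP[/andP[-> ->] /forall_inP]. Qed.

Lemma in_bots S p t : t \in bots p (below S p) ->
  [/\ t \in S, height t (px p) < py p &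
      forall u, u \in below S p -> height u (px p) <= height t (px p)].
Proof. by rewrite !inE => /andP[/andP[-> ->] /forall_inP]. Qed.

Lemma topsD1 S p t l : t \in tops p (above S p) -> t != l ->
  t \in tops p (above (S :\ l) p).
Proof.
rewrite !inE => /andP[/andP[-> ->] /forall_inP tmin] -> /=.
by apply/forall_inP => u; rewrite !inE => /andP[/andP[_ uS] pu]; apply: tmin; rewrite inE uS.
Qed.

Lemma botsD1 S p t l : t \in bots p (below S p) -> t != l ->
  t \in bots p (below (S :\ l) p).
Proof.
rewrite !inE => /andP[/andP[-> ->] /forall_inP tmax] -> /=.
by apply/forall_inP => u; rewrite !inE => /andP[/andP[_ uS] pu]; apply: tmax; rewrite inE uS.
Qed.

Lemma belowE S p : below S p = S :\: (above S p :|: through S p).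
Proof.
apply/setP => i; rewrite !inE /on_line.
by case: (i \in S); rewrite /= ?andbF ?andbT //; case: ltgtP.
Qed.

(** Lines that cut the trapezoid of [p] short on one side: without [l] it would contain a point of
    [l] there. *)
Definition side_stoppers (S : {set I}) p (right up : bool) :=
  [set l in S | [&& l \notin tops p (above S p), l \notin bots p (below S p),
     if up then py p < height l (px p) else height l (px p) < py p &
     [exists q, [&& (px p < px q) == right, on_line q l &
        trapezoid (S :\ l) q == trapezoid (S :\ l) p]]]].

(** The top [t] of [p] (the bottom, when [up] is false) survives the removal of either line. Each of
    two stoppers would be seen past [t] while the other is not, which [no_mutual_crossing] excludes
    for their differences with [t]. *)
Lemma side_stoppers_card_le1 S p right up : (#|side_stoppers S p right up| <= 1)%N.
Proof.
apply: card_le1_in => l1 l2 + l2st; rewrite inE.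
move=> /and5P[l1S l1t l1b l1p /existsP[q1 /and3P[/eqP r1 /eqP q1l /eqP[th1 ab1 to1 bo1]]]].
move: l2st; rewrite inE => /and5P[l2S l2t l2b l2p /existsP[q2 /and3P[/eqP r2 /eqP q2l /eqP[th2 ab2 to2 bo2]]]].
apply/eqP/negPn/negP => l12; have l21 : l2 != l1 by rewrite eq_sym.
have sides : (px p < px q1) = (px p < px q2) by rewrite r1 r2.
case: up l1p l2p => [l1p l2p|l1p l2p].
  have l1a : l1 \in above S p by rewrite inE l1S.
  have l2a : l2 \in above S p by rewrite inE l2S.
  have [t tT] := tops_neq0 p l1a; have [_ _ tmin] := in_tops tT.
  have t1 : t != l1 by apply: contraNneq l1t => <-.
  have t2 : t != l2 by apply: contraNneq l2t => <-.
  have := topsD1 tT t1; rewrite -to1 => /in_tops[_ tq1 tmin1].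
  have := topsD1 tT t2; rewrite -to2 => /in_tops[_ tq2 tmin2].
  have l2q1 : l2 \in above (S :\ l1) q1 by rewrite ab1 !inE l21 l2S.
  have l1q2 : l1 \in above (S :\ l2) q2 by rewrite ab2 !inE l12 l1S.
  have := tmin _ l1a; have := tmin _ l2a; have := tmin1 _ l2q1; have := tmin2 _ l1q2.
  move: tq1 tq2; rewrite q1l q2l /height => h1 h2 h3 h4 h5 h6.
  by apply: (@no_mutual_crossing R (a l1 - a t) (b l1 - b t) (a l2 - a t) (b l2 - b t)
    _ _ _ _ _ _ _ _ _ sides); rewrite mulrBl; lra.
have l1a : l1 \in below S p by rewrite inE l1S.
have l2a : l2 \in below S p by rewrite inE l2S.
have [t tT] := bots_neq0 p l1a; have [_ _ tmax] := in_bots tT.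
have t1 : t != l1 by apply: contraNneq l1b => <-.
have t2 : t != l2 by apply: contraNneq l2b => <-.
have := botsD1 tT t1; rewrite -bo1 => /in_bots[_ tq1 tmax1].
have := botsD1 tT t2; rewrite -bo2 => /in_bots[_ tq2 tmax2].
have E1 : below (S :\ l1) q1 = below (S :\ l1) p by rewrite !belowE th1 ab1.
have E2 : below (S :\ l2) q2 = below (S :\ l2) p by rewrite !belowE th2 ab2.
have l2q1 : l2 \in below (S :\ l1) q1 by rewrite E1 !inE l21 l2S.
have l1q2 : l1 \in below (S :\ l2) q2 by rewrite E2 !inE l12 l1S.
have := tmax _ l1a; have := tmax _ l2a; have := tmax1 _ l2q1; have := tmax2 _ l1q2.
move: tq1 tq2; rewrite q1l q2l /height => h1 h2 h3 h4 h5 h6.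
by apply: (@no_mutual_crossing R (a t - a l1) (b t - b l1) (a t - a l2) (b t - b l2)
  _ _ _ _ _ _ _ _ _ sides); rewrite mulrBl; lra.
Qed.

(** The seven are a line through [p], the top, the bottom, and one stopper for each choice of left
    or right and of above or below. *)
Lemma card_meeting_le7 (S : {set I}) p : (#|[set l in S | meets (S :\ l) l p]| <= 7)%N.
Proof.
pose E0 := [set l in S | on_line p l && free (S :\ l) p].
have E0_le1 : (#|E0| <= 1)%N.
  apply: card_le1_in => l1 l2; rewrite !inE.
  move=> /and3P[l1S pl1 /eqP/setP/(_ l2)] + /and3P[l2S pl2 _].
  by rewrite !inE l2S pl2 !andbT => /negbFE/eqP.
pose st := side_stoppers S p.
have sub : [set l in S | meets (S :\ l) l p] \subset
    E0 :|: (tops p (above S p) :|: (bots p (below S p) :|: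
     (st true true :|: (st true false :|: (st false true :|: st false false))))).
  apply/subsetP => l; rewrite inE => /andP[lS /existsP[q /and3P[ql fq /eqP qp]]].
  rewrite !in_setU.
  have [_|lNt] := boolP (l \in tops _ _); first by rewrite /= orbT.
  have [_|lNb] := boolP (l \in bots _ _); first by rewrite /= !orbT.
  have fp : free (S :\ l) p by case: qp => thE _ _ _; rewrite /free -thE.
  have [pl|plN] := boolP (on_line p l); first by rewrite inE lS pl fp.
  have stE up : (if up then py p < height l (px p) else height l (px p) < py p) ->
      l \in st (px p < px q) up.
    move=> hup; rewrite /st inE lS lNt lNb hup /=.
    by apply/existsP; exists q; rewrite eqxx ql qp /=.
  have [/(stE true)|/(stE false)|pE] := ltgtP (py p) (height l (px p)).
  - by case: (px p < px q) => ->; rewrite !orbT.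
  - by case: (px p < px q) => ->; rewrite !orbT.
  - by rewrite /on_line pE eqxx in plN.
have cardU (A B : {set I}) m n : (#|A| <= m -> #|B| <= n -> #|A :|: B| <= m + n)%N.
  by move=> hA hB; apply: leq_trans (leq_card_setU A B) (leq_add hA hB).
apply: leq_trans (subset_leq_card sub) _.
apply: (@cardU _ _ 1 6) => //; apply: (@cardU _ _ 1 5); first exact: tops_card_le1.
apply: (@cardU _ _ 1 4); first exact: bots_card_le1.
apply: (@cardU _ _ 1 3); first exact: side_stoppers_card_le1.
apply: (@cardU _ _ 1 2); first exact: side_stoppers_card_le1.
by apply: (@cardU _ _ 1 1); apply: side_stoppers_card_le1.
Qed.

(** * Counting the trapezoids crossed by the sampled lines *)

Definition crossing (u v : I) : R := (b u - b v) / (a v - a u).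

Definition role (S : {set I}) (j : 'I_3) q : {set I} :=
  if j == 0%N :> nat then tops q (above S q)
  else if j == 1%N :> nat then through S q else bots q (below S q).

Lemma role_sub (S : {set I}) j q v : v \in role S j q -> v \in S.
Proof.
rewrite /role; case: ifP => _; first by case/in_tops.
by case: ifP => _; [rewrite inE => /andP[] | case/in_bots].
Qed.

Lemma lt_before_crossing u v x x' : height u x < height v x -> x <= x' ->
  (a u != a v -> x < crossing u v -> x' < crossing u v) ->
  height u x' < height v x'.
Proof.
move=> lt_uv xx' cross; have [auv|auv] := eqVneq (a u) (a v).
  by move: lt_uv; rewrite /height auv; lra.
have [le_a|lt_a] := leP (a u) (a v).
  have := ler_wpM2r (_ : 0 <= x' - x) le_a; rewrite subr_ge0 => /(_ xx').
  by move: lt_uv; rewrite /height !mulrBr; lra.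
have d_gt0 : 0 < a u - a v by rewrite subr_gt0.
have crossE : crossing u v = (b v - b u) / (a u - a v).
  by rewrite /crossing -[b u - _]opprB -[a v - _]opprB invrN mulrNN.
move: (cross auv); rewrite crossE !ltr_pdivlMr // => cross'.
have {cross'} : x' * (a u - a v) < b v - b u.
  by apply: cross'; move: lt_uv; rewrite /height; lra.
by rewrite /height; lra.
Qed.

Section SameTrapezoid.
Variables (S : {set I}) (q q' : X).
Hypotheses (q1 : #|through S q| = 1%N) (q1' : #|through S q'| = 1%N).
Hypothesis keep_order : forall j v u, v \in role S j q -> u \in S -> u != v ->
  (height u (px q) < height v (px q) -> height u (px q') < height v (px q')) /\
  (height v (px q) < height u (px q) -> height v (px q') < height u (px q')).

Lemma height_neq (p : X) u v : #|through S p| = 1%N -> u \in S -> v \in S -> u != v ->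
  height u (px p) != height v (px p).
Proof.
move=> p1 uS vS uv; apply/negP => /eqP huv.
have ut : u \in through S p by rewrite inE uS; apply: generic_points huv.
have vt : v \in through S p.
  by rewrite inE vS; apply: (@generic_points _ _ u) (esym huv); rewrite eq_sym.
have /card_le1_eqP/(_ u v ut vt) : (#|through S p| <= 1)%N by rewrite p1.
by move=> vu; rewrite vu eqxx in uv.
Qed.

(** Suppose [v] is a common top and the middle lines differ. The upper one at [q] lies between the
    other and [v], either at [q] or, as order is kept, at [q']; this contradicts the choice of [v].
    Bottoms are dual. *)
Lemma same_through j v : v \in role S j q -> v \in role S j q' ->
  through S q = through S q'.
Proof.
have /eqP/cards1P[l thq] := q1; have /eqP/cards1P[l' thq'] := q1'.
have lth : l \in through S q by rewrite thq set11.
have lth' : l' \in through S q' by rewrite thq' set11.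
have := lth; rewrite inE => /andP[lS /eqP ql].
have := lth'; rewrite inE => /andP[lS' /eqP ql'].
have lmid : l \in role S (inord 1) q by rewrite /role inordK.
move=> vr vr'; rewrite thq thq'; congr [set _].
apply/eqP/negPn/negP => ll'; have l'l : l' != l by rewrite eq_sym.
have vS := role_sub vr; have [mid_lt mid_gt] := keep_order lmid lS' l'l.
have := vr; have := vr'; rewrite /role.
case: ifP => _; last case: ifP => _.
- move=> /in_tops[_ vq' vmin'] /in_tops[_ vq vmin].
  have vl : l != v by apply: contraTneq vq => <-; rewrite ql ltxx.
  have vl' : l' != v by apply: contraTneq vq' => <-; rewrite ql' ltxx.
  have [lv _] := keep_order vr lS vl; have [_ vl'_gt] := keep_order vr lS' vl'.
  have /lv lv' : height l (px q) < height v (px q) by rewrite -ql.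
  have : ~~ (height v (px q) < height l' (px q)).
    by apply/negP => /vl'_gt; rewrite -ql' ltNge ltW.
  rewrite -leNgt => l'v.
  have [l'l_lt|ll'_lt|/eqP] := ltgtP (height l' (px q)) (height l (px q)).
  + have l_above : l \in above S q' by rewrite inE lS ql' mid_lt.
    by have := vmin' _ l_above; rewrite leNgt lv'.
  + have l'_above : l' \in above S q by rewrite inE lS' ql.
    have := vmin _ l'_above => vl'_le.
    have /eqP := height_neq q1 lS' vS vl'; apply.
    by apply/eqP; rewrite eq_le l'v.
  + by rewrite (negPf (height_neq q1 lS' lS l'l)).
- rewrite thq thq' !inE => /eqP -> /eqP l'E; by rewrite l'E eqxx in ll'.
- move=> /in_bots[_ vq' vmax'] /in_bots[_ vq vmax].
  have vl : l != v by apply: contraTneq vq => <-; rewrite ql ltxx.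
  have vl' : l' != v by apply: contraTneq vq' => <-; rewrite ql' ltxx.
  have [_ lv] := keep_order vr lS vl; have [vl'_lt _] := keep_order vr lS' vl'.
  have /lv lv' : height v (px q) < height l (px q) by rewrite -ql.
  have : ~~ (height l' (px q) < height v (px q)).
    by apply/negP => /vl'_lt; rewrite -ql' ltNge ltW.
  rewrite -leNgt => l'v.
  have [l'l_lt|ll'_lt|/eqP] := ltgtP (height l' (px q)) (height l (px q)).
  + have l'_below : l' \in below S q by rewrite inE lS' ql.
    have := vmax _ l'_below => vl'_le.
    have /eqP := height_neq q1 lS' vS vl'; apply.
    by apply/eqP; rewrite eq_le l'v andbT.
  + have l_below : l \in below S q' by rewrite inE lS ql' mid_gt.
    by have := vmax' _ l_below; rewrite leNgt lv'.
  + by rewrite (negPf (height_neq q1 lS' lS l'l)).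
Qed.

(** The middle line keeps its order with all the others, which fixes the lines above and below; top
    and bottom keep theirs and so stay extreme. *)
Lemma same_trapezoid : through S q = through S q' -> trapezoid S q = trapezoid S q'.
Proof.
move=> thE; have /eqP/cards1P[l thq] := q1.
have lth : l \in through S q by rewrite thq set11.
have := lth; rewrite {1}thE !inE => /andP[lS /eqP ql'].
have := lth; rewrite inE => /andP[_ /eqP ql].
have lmid : l \in role S (inord 1) q by rewrite /role inordK.
have abE : above S q = above S q'.
  apply/setP => u; rewrite !inE; have [uS|//] := boolP (u \in S) => /=.
  have [->|ul] := eqVneq u l; first by rewrite ql ql' !ltxx.
  have [mid_lt mid_gt] := keep_order lmid uS ul; rewrite ql ql'.
  have [/mid_lt h|/mid_gt ->//|/eqP] := ltgtP (height u (px q)) (height l (px q)).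
    by rewrite ltNge ltW.
  by rewrite (negPf (height_neq q1 uS lS ul)).
have beE : below S q = below S q' by rewrite !belowE abE thE.
have topE : tops q (above S q) = tops q' (above S q').
  have sub : tops q (above S q) \subset tops q' (above S q').
    apply/subsetP => t tT; have [tS qt tmin] := in_tops tT.
    have tA : t \in above S q by rewrite inE tS.
    rewrite inE -abE tA; apply/forall_inP => u uA.
    have [->//|ut] := eqVneq u t; have uS : u \in S by move: uA; rewrite inE => /andP[].
    have troleT : t \in role S (inord 0) q by rewrite /role inordK.
    have [_ gt] := keep_order troleT uS ut; apply/ltW/gt.
    by rewrite lt_neqAle tmin // andbT; apply: height_neq => //; rewrite eq_sym.
  apply/eqP; rewrite eqEcard sub /=.
  have [->|/set0Pn[t' /in_tops[tS' qt' _]]] := eqVneq (tops q' (above S q')) set0.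
    by rewrite cards0.
  have tA : t' \in above S q by rewrite abE inE tS'.
  apply: leq_trans (tops_card_le1 S q') _; rewrite card_gt0; apply/set0Pn.
  exact: tops_neq0 tA.
have botE : bots q (below S q) = bots q' (below S q').
  have sub : bots q (below S q) \subset bots q' (below S q').
    apply/subsetP => t tT; have [tS qt tmax] := in_bots tT.
    have tA : t \in below S q by rewrite inE tS.
    rewrite inE -beE tA; apply/forall_inP => u uA.
    have [->//|ut] := eqVneq u t; have uS : u \in S by move: uA; rewrite inE => /andP[].
    have troleT : t \in role S (inord 2) q by rewrite /role inordK.
    have [lt _] := keep_order troleT uS ut; apply/ltW/lt.
    by rewrite lt_neqAle tmax // andbT; apply: height_neq.
  apply/eqP; rewrite eqEcard sub /=.
  have [->|/set0Pn[t' /in_bots[tS' qt' _]]] := eqVneq (bots q' (below S q')) set0.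
    by rewrite cards0.
  have tA : t' \in below S q by rewrite beE inE tS'.
  apply: leq_trans (bots_card_le1 S q') _; rewrite card_gt0; apply/set0Pn.
  exact: bots_neq0 tA.
by rewrite /trapezoid thE abE -topE -botE abE beE.
Qed.

End SameTrapezoid.

(* A trapezoid crossed by the line through [q] is coded by the first crossing to
   the right of [q] of one of its three lines with another line of [S]; the
   triple (middle, (l, l)) codes the absence of such a crossing. *)
Definition crosses (S : {set I}) q (z : 'I_3 * (I * I)) : bool :=
  [&& z.2.1 \in role S z.1 q, z.2.2 \in S, a z.2.2 != a z.2.1
    & px q < crossing z.2.2 z.2.1].

Definition codes (S : {set I}) q (z : 'I_3 * (I * I)) : Prop :=
  (crosses S q z /\
     forall w, crosses S q w -> crossing z.2.2 z.2.1 <= crossing w.2.2 w.2.1) \/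
  ((forall w, ~~ crosses S q w) /\ z.2.1 = z.2.2 /\ z.2.1 \in role S z.1 q).

Lemma codes_role S q z : codes S q z ->
  (z.2.1 \in role S z.1 q) && (z.2.2 \in S).
Proof.
case=> [[/and4P[-> ->]//]|[_ [<- vr]]]; by rewrite vr (role_sub vr).
Qed.

Lemma codes_exist S q : #|through S q| = 1%N -> exists z, codes S q z.
Proof.
move=> q1; have [/existsP[w0 cw0]|/existsPn no] := boolP [exists w, crosses S q w].
  case: (arg_minP (fun w => crossing w.2.2 w.2.1) cw0) => z cz zmin.
  by exists z; left.
have /card_gt0P[l lq] : (0 < #|through S q|)%N by rewrite q1.
by exists (inord 1, (l, l)); right; rewrite /role inordK.
Qed.

(** Let [q] be the left point. The first crossing on its three lines, if any, is also to the right
    of [q'], so these lines keep their order with all of [S] in between, and the role shared through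
    [z] identifies the middle lines. *)
Lemma codes_trapezoid S q q' z :
  #|through S q| = 1%N -> #|through S q'| = 1%N -> codes S q z -> codes S q' z ->
  trapezoid S q = trapezoid S q'.
Proof.
wlog qq' : q q' / px q <= px q'.
  move=> wl h1 h2 h3 h4; have [le|/ltW le] := leP (px q) (px q'); first exact: wl.
  by apply/esym; apply: wl.
move=> q1 q1' cz cz'.
have later j v u : v \in role S j q -> u \in S -> a u != a v ->
    px q < crossing u v -> px q' < crossing u v.
  move=> vr uS auv lt_q; have cw : crosses S q (j, (v, u)) by apply/and4P.
  case: cz => [[czq zmin]|[no _]]; last by have := no (j, (v, u)); rewrite cw.
  apply: lt_le_trans (zmin _ cw).
  case: cz' => [[/and4P[]]//|[_ [zE _]]].
  by move: czq; rewrite /crosses zE eqxx andbF /= andbF.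
have crossingC u v : crossing u v = crossing v u.
  by rewrite /crossing -[b u - _]opprB -[a v - _]opprB invrN mulrNN.
have keep j v u : v \in role S j q -> u \in S -> u != v ->
  (height u (px q) < height v (px q) -> height u (px q') < height v (px q')) /\
  (height v (px q) < height u (px q) -> height v (px q') < height u (px q')).
  move=> vr uS uv; split=> lt_uv; apply: lt_before_crossing lt_uv qq' _ => auv.
    exact: later vr uS auv.
  by rewrite crossingC; apply: later vr uS _; rewrite eq_sym.
apply: (same_trapezoid q1 keep).
have /andP[vr _] := codes_role cz; have /andP[vr' _] := codes_role cz'.
exact: (same_through q1 q1' keep vr vr').
Qed.

(** A trapezoid of [S :\ l] met by [l] comes from a label of [S] with middle line [l] by emptying
    its first component. Labels with different middle lines differ, and each has a code in ['I_3]
    times [S] times [S]. *)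
Lemma sum_met_trapezoids (S : {set I}) :
  (\sum_(l in S) #|met_trapezoids (S :\ l) l| <= 3 * #|S| ^ 2)%N.
Proof.
pose Q := [set q | #|through S q| == 1%N].
have /choice[code codeP] : forall q : X, exists z : option ('I_3 * (I * I)),
    q \in Q -> exists2 w, z = Some w & codes S q w.
  move=> q; have [qQ|_] := boolP (q \in Q); last by exists None.
  move: qQ; rewrite inE => /eqP/codes_exist[w cw].
  by exists (Some w) => _; exists w.
have card_labels : (#|trapezoid S @: Q| <= 3 * #|S| ^ 2)%N.
  apply: (@leq_trans #|code @: Q|).
    apply: leq_card_imset_coded => q q' qQ q'Q cE.
    have [w wE cw] := codeP q qQ; have [w' wE' cw'] := codeP q' q'Q.
    move: cE; rewrite wE wE' => -[ww']; rewrite -ww' in cw'.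
    by apply: codes_trapezoid cw cw'; apply/eqP; [move: qQ | move: q'Q]; rewrite inE.
  apply: (@leq_trans #|[set Some z | z in setX [set: 'I_3] (setX S S)]|).
    apply/subset_leq_card/subsetP => _ /imsetP[q qQ ->].
    have [w -> cw] := codeP q qQ; apply: imset_f.
    by have /andP[vr uS] := codes_role cw; rewrite !inE /= (role_sub vr).
  by apply: leq_trans (leq_imset_card _ _) _; rewrite !cardsX cardsT card_ord expnS expn1.
apply: leq_trans card_labels; set L := trapezoid S @: Q.
pose forget (z : {set I} * {set I} * {set I} * {set I}) : {set I} * {set I} * {set I} * {set I} :=
  (set0, z.1.1.2, z.1.2, z.2).
apply: (@leq_trans (\sum_(l in S) #|[set z in L | z.1.1.1 == [set l]]|)).
  apply: leq_sum => l lS; apply: leq_trans (leq_imset_card forget _).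
  apply/subset_leq_card/subsetP => _ /imsetP[q /[!inE] /andP[ql /eqP fq] ->].
  have thq : through S q = [set l].
    apply/setP => u; rewrite !inE; have [->|ul] := eqVneq u l; first by rewrite lS.
    by move/setP/(_ u): fq; rewrite !inE ul.
  have abE : above (S :\ l) q = above S q.
    apply/setP => u; rewrite !inE; have [->|//] := eqVneq u l.
    by rewrite (eqP ql) ltxx !andbF.
  have beE : below (S :\ l) q = below S q.
    apply/setP => u; rewrite !inE; have [->|//] := eqVneq u l.
    by rewrite (eqP ql) ltxx !andbF.
  apply/imsetP; exists (trapezoid S q); last by rewrite /trapezoid fq abE beE.
  by rewrite inE /= thq eqxx andbT; apply: imset_f; rewrite inE thq cards1.
under eq_bigr => l _ do rewrite -sum1_card.
rewrite (exchange_big_dep (mem L)) /=; last by move=> l z _; rewrite inE => /andP[].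
rewrite -[leqRHS]sum1_card; apply: leq_sum => z zL; rewrite sum1_card.
apply/card_le1_eqP => l l' /andP[_ lz] /andP[_ lz'].
have : z \in [set z in L | z.1.1.1 == [set l]] := lz.
have : z \in [set z in L | z.1.1.1 == [set l']] := lz'.
by rewrite !inE => /andP[_ /eqP->] /andP[_ /eqP/set1_inj].
Qed.

End Sampling.

(** * Finding a dense group of points *)

Lemma sum_deleted (I : finType) (r : nat) (F : {set I} -> I -> nat) :
  (\sum_(S : {set I} | #|S| == r) \sum_(l | l \notin S) F S l =
   \sum_(S : {set I} | #|S| == r.+1) \sum_(l in S) F (S :\ l) l)%N.
Proof.
rewrite !pair_big_dep /=.
rewrite (reindex_onto (fun z : {set I} * I => (z.1 :\ z.2, z.2))
                      (fun z => (z.2 |: z.1, z.2))) /=; last first.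
  by move=> [S l] /andP[_ lS] /=; rewrite setU1K.
apply: eq_bigl => -[S l] /=; rewrite !inE eqxx andbT /=.
have [lS|lNS] := boolP (l \in S).
  by rewrite setD1K // eqxx andbT andbT (cardsD1 l S) lS.
rewrite andbF; apply/negP => /andP[_ /eqP[SE]].
by move: lNS; rewrite -SE setU11.
Qed.

(* Backwards analysis: deleting a uniformly random element of a random
   [(r+1)]-subset yields a random [r]-subset with a random new element. *)
Lemma exists_sample (I : finType) (r K : nat) (F : {set I} -> I -> nat) :
  (r <= #|I|)%N ->
  (forall S : {set I}, #|S| = r.+1 -> (\sum_(l in S) F (S :\ l) l <= K)%N) ->
  exists2 S : {set I}, #|S| = r &
    (r.+1 * \sum_(l | l \notin S) F S l <= #|I| * K)%N.
Proof.
move=> rI FK.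
have [/existsP[S /andP[/eqP Sr hS]]|/existsPn no] := boolP [exists S : {set I},
    (#|S| == r) && (r.+1 * \sum_(l | l \notin S) F S l <= #|I| * K)%N]; first by exists S.
exfalso.
have total : (\sum_(S : {set I} | #|S| == r) \sum_(l | l \notin S) F S l
    <= 'C(#|I|, r.+1) * K)%N.
  rewrite sum_deleted -card_draws -sum_nat_const big_mkcond [leqRHS]big_mkcond /=.
  by apply: leq_sum => S _; rewrite inE; case: eqP => // /FK.
(* Integrality gives the successor here, which makes the final comparison strict. *)
have lower : ('C(#|I|, r) * (#|I| * K).+1 <=
    \sum_(S : {set I} | #|S| == r) r.+1 * \sum_(l | l \notin S) F S l)%N.
  rewrite -card_draws -sum_nat_const big_mkcond [leqRHS]big_mkcond /=.
  by apply: leq_sum => S _; rewrite inE; case: ifP => // Sr; have := no S; rewrite Sr -ltnNge.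
have C0 : (0 < 'C(#|I|, r))%N by rewrite bin_gt0.
have := leq_trans lower _; rewrite -big_distrr /= => /(_ (r.+1 * ('C(#|I|, r.+1) * K))%N).
rewrite leq_mul2l total orbT => /(_ isT); rewrite mulnA mul_bin_left.
apply/negP; rewrite -ltnNge.
apply: (@leq_ltn_trans (#|I| * 'C(#|I|, r) * K)%N).
  by rewrite !leq_mul2r leq_subr !orbT.
by rewrite mulnS -mulnA mulnCA -[X in (X < _)%N]add0n ltn_add2r.
Qed.

(** Cut each class into blocks of [m0] consecutive ranks. A class of size [s] has at most
    [s / m0 + 1] blocks, whence one extra [m0] per class met. *)
Lemma split_classes (X K : finType) (kappa : X -> K) (m0 : nat) : (0 < m0)%N ->
  exists (G : finType) (g : X -> G),
    (forall y, #|[set x | g x == y]| <= m0)%N /\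
    forall A : {set X}, (m0 * #|g @: A| <=
      m0 * #|kappa @: A| + #|[set x | kappa x \in kappa @: A]|)%N.
Proof.
move=> m0_gt0; pose cl c := [set x | kappa x == c].
pose rk x := index x (enum (cl (kappa x))).
have rk_lt x : (rk x < #|cl (kappa x)|)%N.
  by rewrite /rk cardE index_mem mem_enum inE.
have lt_ord x : (rk x %/ m0 < #|X|.+1)%N.
  by rewrite ltnS (leq_trans (leq_div _ _)) // (leq_trans (ltnW (rk_lt x))) // max_card.
exists (K * 'I_#|X|.+1)%type, (fun x => (kappa x, Ordinal (lt_ord x))); split.
  move=> [c i]; rewrite -[leqRHS]card_ord.
  apply: (@leq_card_in _ _ (fun x => Ordinal (ltn_pmod (rk x) m0_gt0))) => x y.
  rewrite !inE => /eqP[kx ix] /eqP[ky iy] /(congr1 val) /= modE.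
  have divE : (rk x %/ m0 = rk y %/ m0)%N := congr1 val (etrans ix (esym iy)).
  have rkE : rk x = rk y.
    by rewrite (divn_eq (rk x) m0) (divn_eq (rk y) m0) modE divE.
  have kE : kappa x = kappa y by rewrite kx ky.
  have xin : x \in enum (cl (kappa x)) by rewrite mem_enum inE.
  have yin : y \in enum (cl (kappa x)) by rewrite mem_enum inE kE.
  by rewrite -(nth_index x xin) -(nth_index x yin) -/(rk x) rkE /rk kE.
move=> A.
have -> : #|[set x | kappa x \in kappa @: A]| = (\sum_(c in kappa @: A) #|cl c|)%N.
  rewrite -sum1_card (partition_big kappa (mem (kappa @: A))) /=; last first.
    by move=> x; rewrite inE.
  apply: eq_bigr => c cA; rewrite -sum1_card; apply: eq_bigl => x; rewrite !inE.
  by case: eqP => [->|]; rewrite ?cA ?andbF.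
apply: (@leq_trans (\sum_(c in kappa @: A) (m0 + #|cl c|))); last first.
  by rewrite big_split /= sum_nat_const mulnC.
apply: (@leq_trans (m0 * \sum_(c in kappa @: A) (#|cl c| %/ m0).+1)); last first.
  rewrite big_distrr; apply: leq_sum => c _ /=.
  by rewrite mulnS leq_add2l mulnC leq_trunc_div.
rewrite leq_mul2l; apply/orP; right.
apply: (@leq_trans #|[set z : K * 'I_#|X|.+1 |
    (z.1 \in kappa @: A) && (z.2 < (#|cl z.1| %/ m0).+1)%N]|).
  apply/subset_leq_card/subsetP => _ /imsetP[x xA ->]; rewrite inE /= imset_f //=.
  by rewrite ltnS leq_div2r // ltnW.
rewrite -sum1_card; under eq_bigl => z do rewrite inE.
rewrite -(pair_big_dep (mem (kappa @: A)) 
  (fun c (i : 'I_#|X|.+1) => i < (#|cl c| %/ m0).+1)%N (fun _ _ => 1%N)) /=.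
apply: leq_sum => c _; rewrite sum1_card.
rewrite -[leqRHS]card_ord; set N := (_ %/ _).+1.
apply: (@leq_card_in _ _ (fun i : 'I_#|X|.+1 => inord i : 'I_N)) => i j iN jN.
move=> /(congr1 val); rewrite /= !inordK // => ij; exact: val_inj.
Qed.

Section DenseGroup.
Variables (R : realFieldType) (X I : finType) (px py : X -> R) (a b : I -> R).
Let inc := on_line px py a b.
Hypothesis lin : partial_linear inc.
Hypothesis generic_points : forall p i j,
  i != j -> height a b i (px p) = height a b j (px p) -> inc p i.

(** In [loss], the term [2 * n * r] pays for incidences at points on sampled lines or with sampled
    lines; the rest charges [2 * k] to each unsampled line and group that it meets off the
    sample. *)
Lemma exists_dense_group (r m0 k n : nat) :
  #|X| = n -> #|I| = n -> (r <= n)%N -> (0 < m0)%N -> (0 < k)%N ->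
  let loss : R := (2 * n * r)%:R
    + (2 * k * n)%:R * (3 * r.+1%:R + 7 * n%:R / (r.+1%:R * m0%:R)) in
  let Z := (\sum_i #|points_on inc i|)%N%:R - loss in
  0 < Z ->
  exists g : {set X}, [/\ (0 < #|g| <= m0)%N &
    Z / 2 * #|g|%:R <=
    n%:R * (\sum_(i | 2 * k <= #|g :&: points_on inc i|) #|g :&: points_on inc i|)%N%:R].
Proof.
move=> cX cI rn m0_gt0 k_gt0 loss Z Z_gt0.
pose F S l := (m0 * #|met_trapezoids px py a b S l|
               + #|[set p | meets px py a b S l p]|)%N.
have [||S Sr hS] := @exists_sample I r (m0 * (3 * r.+1 ^ 2) + 7 * n) F; first by rewrite cI.
  move=> S Sr; rewrite big_split /= -big_distrr /=; apply: leq_add.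
    by rewrite leq_mul2l -Sr sum_met_trapezoids ?orbT.
  under eq_bigr => l _ do rewrite -sum1_card.
  rewrite (exchange_big_dep predT) //= mulnC -cX -sum_nat_const.
  apply: leq_sum => p _; rewrite sum1_card.
  apply: leq_trans (card_meeting_le7 generic_points S p).
  by apply/subset_leq_card/subsetP => l; rewrite unfold_in !inE.
have [G [g [g_le g_im]]] := split_classes (trapezoid px py a b S) m0_gt0.
pose A l := [set q | inc q l && free px py a b S q].
have A_im l : (m0 * #|g @: A l| <= F S l)%N.
  apply: leq_trans (g_im (A l)) _; rewrite leq_add2l.
  apply/subset_leq_card/subsetP => p; rewrite !inE => /imsetP[q].
  rewrite inE => /andP[ql fq] pq; apply/existsP; exists q.
  by rewrite -/inc; apply/and3P; split => //; rewrite pq.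
have A_big : ((\sum_i #|points_on inc i|) <= \sum_(i | i \notin S) #|A i| + 2 * n * r)%N.
  rewrite (bigID (mem S)) /= addnC.
  have inS : (\sum_(i in S) #|points_on inc i| <= n * r)%N.
    rewrite mulnC -Sr -sum_nat_const; apply: leq_sum => i _.
    by rewrite -cX max_card.
  have outS : (\sum_(i | i \notin S) #|points_on inc i| <=
      \sum_(i | i \notin S) #|A i| + n * r)%N.
    apply: (@leq_trans (\sum_(i | i \notin S) (#|A i| + r))).
      apply: leq_sum => i iS; rewrite -(cardsID (A i) (points_on inc i)).
      apply: leq_add; first by apply/subset_leq_card/subsetIr.
      (* [h] sends a point of [i] covered by the sample to a sampled line through it. Two points
         with the same image would put [i] in [S], so at most [r] points are lost. *)
      pose h x := if [pick j in S | inc x j] is Some j then j else i.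
      have hP x : x \in points_on inc i :\: A i -> (h x \in S) && inc x (h x).
        rewrite !inE /h => /andP[+ xi]; rewrite xi /= => /set0Pn[j].
        rewrite inE => /andP[jS xj]; case: pickP => [//|/(_ j)].
        by rewrite jS /inc xj.
      rewrite -Sr -(@card_in_imset _ _ h).
        by apply/subset_leq_card/subsetP => _ /imsetP[x /hP/andP[hS' _] ->].
      move=> x y xD yD hxy; apply/eqP/negPn/negP => xy.
      have /andP[hxS xh] := hP x xD; have /andP[_ yh] := hP y yD.
      have xi : inc x i by move: xD; rewrite !inE => /andP[].
      have yi : inc y i by move: yD; rewrite !inE => /andP[].
      by move: iS; rewrite (lin xy xi yi xh) ?hxS // hxy.
    rewrite big_split /= leq_add2l sum_nat_const leq_mul2r.
    by rewrite -cI max_card orbT.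
  by move: inS outS; clear; lia.
pose gy y := [set x | g x == y].
pose J y := (\sum_(i | 2 * k <= #|gy y :&: points_on inc i|) #|gy y :&: points_on inc i|)%N.
have split_A i : (#|A i| <= \sum_(y | 2 * k <= #|gy y :&: points_on inc i|)
    #|gy y :&: points_on inc i| + 2 * k * #|g @: A i|)%N.
  have -> : #|A i| = (\sum_(y in g @: A i) #|gy y :&: A i|)%N.
    rewrite -sum1_card (partition_big g (mem (g @: A i))) /=; last exact: imset_f.
    apply: eq_bigr => y _; rewrite -sum1_card; apply: eq_bigl => x.
    by rewrite !inE andbC.
  apply: (@leq_trans (\sum_(y in g @: A i) ((if (2 * k <= #|gy y :&: points_on inc i|)%N
     then #|gy y :&: points_on inc i| else 0) + 2 * k))%N).
    apply: leq_sum => y _.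
    have le1 : (#|gy y :&: A i| <= #|gy y :&: points_on inc i|)%N.
      apply/subset_leq_card/setIS/subsetP => x; rewrite !inE; by case/andP.
    case: (leqP (2 * k) #|gy y :&: points_on inc i|) => [_|/ltnW]; first by rewrite (leq_trans le1) // leq_addr.
    by rewrite add0n; apply: leq_trans.
  rewrite big_split /= sum_nat_const [(#|_| * (2 * k))%N]mulnC leq_add2r.
  rewrite [leqRHS]big_mkcond /= [leqLHS]big_mkcond /=.
  by apply: leq_sum => y _; case: ifP.
have J_big : Z <= (\sum_y J y)%N%:R.
  have : ((\sum_i #|points_on inc i|) <=
      \sum_y J y + 2 * k * (\sum_(i | i \notin S) #|g @: A i|) + 2 * n * r)%N.
    apply: leq_trans A_big _; rewrite leq_add2r.
    apply: leq_trans (_ : \sum_(i | i \notin S) (_ + _) <= _)%N.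
      by apply: leq_sum => i _; apply: split_A.
    rewrite big_split /= -big_distrr /= leq_add2r.
    rewrite /J (exchange_big_dep predT) //=.
    apply: leq_sum => y _; rewrite big_mkcond [leqRHS]big_mkcond /=.
    by apply: leq_sum => i _; case: (i \in S) => //=; case: ifP.
  rewrite -(ler_nat R) !natrD natrM => /le_trans le_tot.
  have pairs : (\sum_(i | i \notin S) #|g @: A i|)%N%:R <=
      n%:R * (3 * r.+1%:R + 7 * n%:R / (r.+1%:R * m0%:R)) :> R.
    have : (r.+1 * (m0 * \sum_(i | i \notin S) #|g @: A i|) <=
        n * (m0 * (3 * r.+1 ^ 2) + 7 * n))%N.
      rewrite -cI in hS *; apply: leq_trans hS; rewrite leq_mul2l /= big_distrr /=.
      by apply: leq_sum => i _; apply: A_im.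
    rewrite -(ler_nat R) !natrM !natrD !natrM.
    have r0 : 0 < r.+1%:R :> R by rewrite ltr0n.
    have m00 : 0 < m0%:R :> R by rewrite ltr0n.
    set s := (\sum_(_ | _) _)%N%:R; move: r0 m00.
    move: (r.+1%:R) (m0%:R) (n%:R : R) => r' m' n' r0 m00 hs.
    rewrite -(ler_pM2l (mulr_gt0 r0 m00)).
    have -> : r' * m' * (n' * (3 * r' + 7 * n' / (r' * m'))) =
        n' * (m' * (3 * r' ^+ 2) + 7 * n') by field; rewrite !gt_eqF.
    by move: hs; lra.
  have := ler_wpM2l (_ : 0 <= (2 * k)%:R) pairs => /(_ (ler0n _ _)).
  have := le_tot _ (lexx _); rewrite /Z /loss.
  rewrite [(2 * k * n)%:R]natrM -[(2 * k)%:R * n%:R * _]mulrA.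
  move: ((2 * k)%:R * (n%:R * _)) ((2 * k)%:R * _) => u v.
  by move: (_%:R) (_%:R) (_%:R) => w1 w2 w3; lra.
(* Averaging over groups, whose sizes add up to [n]; the half in [Z / 2] makes the contradiction
   strict. *)
have [/existsP[y /andP[gy0 hy]]|/existsPn no] := boolP [exists y,
    (0 < #|gy y|)%N && (Z / 2 * #|gy y|%:R <= n%:R * (J y)%:R)].
  by exists (gy y); rewrite gy0 g_le.
exfalso.
have n_gt0 : 0 < n%:R :> R.
  rewrite ltr0n lt0n; apply/eqP => n0.
  move: Z_gt0; rewrite /Z big1; last by move=> i _; apply/eqP; rewrite -leqn0 -n0 -cX max_card.
  by rewrite /loss n0 !muln0 mul0r addr0 subr0 ltxx.
have : n%:R * (\sum_y J y)%N%:R <= Z / 2 * n%:R.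
  have nE : n%:R = \sum_y #|gy y|%:R :> R.
    rewrite -natr_sum -cX -sum1_card (partition_big g predT) //=; congr (_%:R).
    by apply: eq_bigr => y _; rewrite -sum1_card; apply: eq_bigl => x; rewrite inE.
  rewrite [X in _ <= _ * X]nE.
  rewrite natr_sum !mulr_sumr; apply: ler_sum => y _.
  have := no y; rewrite negb_and -leqNgt leqn0 cards_eq0 => /orP[/eqP y0|].
    rewrite y0 cards0 mulr0 /J big1 ?mulr0 // => i.
    by rewrite y0 set0I cards0 leqn0 muln_eq0 (gtn_eqF k_gt0).
  by rewrite -ltNge => /ltW.
have := ler_wpM2l (ltW n_gt0) J_big; have := mulr_gt0 n_gt0 Z_gt0; lra.
Qed.

End DenseGroup.

Lemma exists_clique_of_incidences (R : archiRealFieldType) (k : nat) (c : R) :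
  (0 < k)%N -> 0 < c ->
  exists nu0 : R, forall (X I : finType) (px py : X -> R) (a b : I -> R) (nu : R),
    let inc := on_line px py a b in
    partial_linear inc ->
    (forall p i j, i != j -> height a b i (px p) = height a b j (px p) -> inc p i) ->
    nu0 <= nu -> nu ^+ 3 = #|X|%:R -> #|I| = #|X| ->
    c * nu ^+ 4 <= (\sum_i #|points_on inc i|)%N%:R ->
    exists W : seq X,
      [/\ uniq W, size W = k,
          {in W &, forall x y, x != y -> exists i, inc x i && inc y i} &
          {in W & &, forall x y z, x != y -> x != z -> y != z ->
             forall i, ~~ [&& inc x i, inc y i & inc z i]}].
Proof.
move=> k_gt0 c_gt0; have k0 : 0 < k%:R :> R by rewrite ltr0n.
pose e : R := Num.min c 1.
have e_gt0 : 0 < e by rewrite lt_min c_gt0 ltr01.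
have e_lec : e <= c by rewrite ge_min lexx.
have e_le1 : e <= 1 by rewrite ge_min lexx orbT.
(* The terms of [loss] linear in [r], namely [2 * delta] and [6 * k * delta] times [nu ^+ 4], then
   sum to [e / 8]. *)
pose delta : R := e / (8 * (6 * k%:R + 2)).
have d6 : 0 < 8 * (6 * k%:R + 2) :> R by lra.
have delta_gt0 : 0 < delta by rewrite divr_gt0.
have deltaE : (6 * k%:R + 2) * delta = e / 8.
  by rewrite /delta; field; rewrite gt_eqF //; lra.
have delta_le1 : delta <= 1.
  by rewrite ler_pdivrMr // mul1r; lra.
(* The term [14 * k / (delta * M)], due to the constant 7, then equals [e / 8]. *)
pose M : R := 112 * k%:R / (delta * e).
have M_gt0 : 0 < M by apply: divr_gt0; apply: mulr_gt0.
have ME : delta * M * (e / 8) = 14 * k%:R.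
  by rewrite /M; field; rewrite !gt_eqF.
pose c1 := e / (8 * M).
have c1_gt0 : 0 < c1 by apply: divr_gt0 => //; apply: mulr_gt0.
have c1E : c1 * (2 * M) = e / 4 by rewrite /c1; field; rewrite gt_eqF.
have [m1 Hm1] := linear_space_generic_clique k_gt0 c1_gt0.
(* Beyond 1, the summands absorb the successor in [r.+1], absorb that in [m0], and force the group
   to have at least [m1] points. *)
exists (1 + 48 * k%:R / e + M^-1 + 8 * m1%:R / e).
move=> X I px py a b nu inc lin gen nu_ge nu3 cI Hinc.
have t1 : 0 <= 48 * k%:R / e by apply: divr_ge0; [apply: mulr_ge0 | apply: ltW].
have t2 : 0 < M^-1 by rewrite invr_gt0.
have t3 : 0 <= 8 * m1%:R / e by apply: divr_ge0; [apply: mulr_ge0 | apply: ltW].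
have nu_ge1 : 1 <= nu by lra.
have nu_gt0 : 0 < nu by lra.
have nu_k : 48 * k%:R <= e * nu.
  by rewrite [leRHS]mulrC -ler_pdivrMr //; lra.
have nu_M : 1 <= M * nu.
  by rewrite [leRHS]mulrC -ler_pdivrMr // mul1r; lra.
have nu_m1 : 8 * m1%:R <= e * nu.
  by rewrite [leRHS]mulrC -ler_pdivrMr //; lra.
pose n := #|X|; pose r := Num.trunc (delta * nu); pose m0 := (Num.trunc (M * nu)).+1.
have dnu0 : 0 < delta * nu by rewrite mulr_gt0.
have Mnu0 : 0 < M * nu by rewrite mulr_gt0.
have /andP[r_le r_lt] := truncn_itv (ltW dnu0); rewrite -/r in r_le r_lt.
have /andP[m_le m_lt] := truncn_itv (ltW Mnu0); rewrite -/m0 in m_lt.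
have m0_le : m0%:R <= 2 * M * nu.
  by rewrite /m0 -natr1; lra.
have nu_le_n : nu <= n%:R.
  by rewrite -nu3 exprS ler_peMr // ?exprn_ege1 // ltW.
have rn : (r <= n)%N.
  rewrite -(ler_nat R); apply: le_trans r_le (le_trans _ nu_le_n).
  by rewrite ler_piMl // ltW.
have nu4 : 0 < nu ^+ 4 by rewrite exprn_gt0.
have nu3_gt0 : 0 < nu ^+ 3 by rewrite exprn_gt0.
have nu4E : nu ^+ 4 = nu ^+ 3 * nu by rewrite exprSr.
pose loss : R := (2 * n * r)%:R
  + (2 * k * n)%:R * (3 * r.+1%:R + 7 * n%:R / (r.+1%:R * m0%:R)).
pose Z : R := (\sum_i #|points_on inc i|)%N%:R - loss.
have dense : 0 < Z -> exists g : {set X}, [/\ (0 < #|g| <= m0)%N &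
    Z / 2 * #|g|%:R <=
    n%:R * (\sum_(i | 2 * k <= #|g :&: points_on inc i|) #|g :&: points_on inc i|)%N%:R].
  exact: (@exists_dense_group R X I px py a b lin gen r m0 k n erefl cI rn isT k_gt0).
have loss_le : loss <= 3 / 8 * e * nu ^+ 4.
  have l1 : (2 * n * r)%:R <= 2 * delta * nu ^+ 4.
    rewrite !natrM -nu3 nu4E -mulrA [leRHS](_ : _ = 2 * (nu ^+ 3 * (delta * nu))); last by ring.
    by rewrite ler_wpM2l // ler_wpM2l // ltW.
  have l2 : (2 * k * n)%:R * (3 * r.+1%:R) <= 6 * k%:R * delta * nu ^+ 4 + e / 8 * nu ^+ 4.
    rewrite !natrM -nu3 -natr1.
    have h1 : k%:R * nu ^+ 3 * r%:R <= k%:R * nu ^+ 3 * (delta * nu).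
      by rewrite ler_wpM2l // mulr_ge0 // ltW.
    have h2 : nu ^+ 3 * (48 * k%:R) <= nu ^+ 3 * (e * nu) by rewrite ler_wpM2l // ltW.
    by rewrite nu4E; lra.
  have l3 : (2 * k * n)%:R * (7 * n%:R / (r.+1%:R * m0%:R)) <= e / 8 * nu ^+ 4.
    have rm : delta * nu * (M * nu) <= r.+1%:R * m0%:R.
      by apply: ler_pM; rewrite ltW.
    have rm0 : 0 < r.+1%:R * m0%:R :> R by rewrite mulr_gt0 ?ltr0n.
    rewrite mulrA ler_pdivrMr //.
    apply: le_trans (ler_wpM2l _ rm); last by apply: mulr_ge0; apply: ltW => //; lra.
    rewrite !natrM -nu3 le_eqVlt; apply/orP; left; apply/eqP.
    have -> : e / 8 * nu ^+ 4 * (delta * nu * (M * nu)) = delta * M * (e / 8) * nu ^+ 6 by ring.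
    by rewrite ME; ring.
  rewrite /loss mulrDr; apply: le_trans (lerD l1 (lerD l2 l3)) _.
  have : (6 * k%:R + 2) * delta * nu ^+ 4 = e / 8 * nu ^+ 4 by rewrite deltaE.
  by clear; lra.
have Z_ge : e / 2 * nu ^+ 4 <= Z.
  have : e * nu ^+ 4 <= c * nu ^+ 4 by rewrite ler_wpM2r // ltW.
  have : 0 < e * nu ^+ 4 by rewrite mulr_gt0.
  by rewrite /Z; move: Hinc loss_le; clear; lra.
have Z_gt0 : 0 < Z by apply: lt_le_trans Z_ge; rewrite mulr_gt0 // divr_gt0.
have [g [/andP[g_gt0 g_le]]] := dense Z_gt0.
set J := (\sum_(i | _) _)%N => HJ.
have g0 : 0 < #|g|%:R :> R by rewrite ltr0n.
have {}HJ : e / 4 * nu * #|g|%:R <= J%:R.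
  rewrite -(ler_pM2l nu3_gt0); rewrite -nu3 in HJ; apply: le_trans HJ.
  have := ler_wpM2r (ltW g0) Z_ge; rewrite nu4E; lra.
pose Y := {x : X | x \in g}; pose incY (y : Y) i := inc (val y) i.
have linY : partial_linear incY.
  by move=> x y i j xy; apply: lin; rewrite (inj_eq val_inj).
have cY : #|{: Y}| = #|g| by rewrite card_sig; apply: eq_card => x; rewrite inE.
have ptsY i : #|points_on incY i| = #|g :&: points_on inc i|.
  rewrite -(card_imset (mem (points_on incY i)) val_inj); apply: eq_card => x; rewrite !inE.
  apply/imsetP/andP => [[y yi ->]|[xg xi]].
    by split; [exact: valP | move: yi; rewrite inE].
  by exists (exist _ x xg) => //; rewrite inE.
have JE : J = (\sum_(i | 2 * k <= #|points_on incY i|) #|points_on incY i|)%N.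
  by apply: eq_big => [i|i _]; rewrite ptsY.
have [||W [uW sW adjW colW]] := Hm1 Y I incY linY.
(* The group cannot be small: it has at least [e / 4 * nu * #|g|] incidences but at most
   [2 * #|g| ^ 2]. *)
- have : (J <= 2 * #|g| ^ 2)%N.
    apply: (@leq_trans (\sum_(i | 1 < #|points_on incY i|) #|points_on incY i| ^ 2)%N).
      rewrite JE big_mkcond [leqRHS]big_mkcond; apply: leq_sum => i _.
      case: ifP => // ti; rewrite (leq_trans (leq_pmulr 2 k_gt0) ti).
      by rewrite expnS expn1 leq_pmulr // (leq_trans _ ti) // muln_gt0.
    by rewrite -cY sum_card_points_on_sqr.
  rewrite -(ler_nat R) natrM natrX expr2 => /(le_trans HJ).
  rewrite mulrA ler_pM2r // => h; rewrite cY -(ler_nat R); lra.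
- rewrite -JE cY; apply: le_trans HJ.
  rewrite expr2 mulrA ler_pM2r // -c1E.
  have : #|g|%:R <= 2 * M * nu by apply: le_trans m0_le; rewrite ler_nat.
  by move/(ler_wpM2l (ltW c1_gt0)); clear; lra.
exists (map val W); split.
- by rewrite map_inj_uniq //; apply: val_inj.
- by rewrite size_map.
- move=> _ _ /mapP[x xW ->] /mapP[y yW ->]; rewrite (inj_eq val_inj) => xy.
  exact: adjW.
- move=> _ _ _ /mapP[x xW ->] /mapP[y yW ->] /mapP[z zW ->].
  by rewrite !(inj_eq val_inj) => xy xz yz i; apply: colW.
Qed.

(** * Lines in the plane *)

Lemma exists_gt_all (R : realFieldType) (s : seq R) : exists t, {in s, forall x, x < t}.
Proof.
elim: s => [|y s [t Ht]]; first by exists 0.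
exists (Num.max t (y + 1)) => x; rewrite inE lt_max => /predU1P[->|/Ht->//].
by rewrite ltrDl ltr01 orbT.
Qed.

(* The shear [(u, v) |-> (u + t * v, v)] is generic for large [t]: writing [e i x]
   for the residue of the equation of line [i] at point [x], the sheared lines [i]
   and [j] have equal heights above [x] only for one value of [t], unless both
   contain [x]. *)
Lemma exists_generic_coordinates (R : realFieldType) (X I : finType)
    (pt : X -> R * R) (A B C : I -> R) :
  injective pt ->
  (forall i, (A i, B i) <> (0, 0)) ->
  (forall i j, (forall q : R * R, (A i * q.1 + B i * q.2 == C i)
                               = (A j * q.1 + B j * q.2 == C j)) -> i = j) ->
  exists (px py : X -> R) (a b : I -> R),
    [/\ forall x i, on_line px py a b x i = (A i * (pt x).1 + B i * (pt x).2 == C i),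
        partial_linear (on_line px py a b) &
        forall x i j, i != j -> height a b i (px x) = height a b j (px x) ->
          on_line px py a b x i].
Proof.
move=> pt_inj AB_neq0 line_inj.
pose e i x := C i - A i * (pt x).1 - B i * (pt x).2.
(* The shear [bad1 i] would make line [i] vertical, and [bad2 (i, j, x)] would equalise two heights
   above [x]. A zero denominator only adds a harmless value to avoid. *)
pose bad1 i := B i / A i.
pose bad2 (z : I * I * X) := (e z.1.1 z.2 * B z.1.2 - e z.1.2 z.2 * B z.1.1)
  / (e z.1.1 z.2 * A z.1.2 - e z.1.2 z.2 * A z.1.1).
have [t Ht] := exists_gt_all ([seq bad1 i | i <- enum I] ++ [seq bad2 z | z <- enum {: I * I * X}]).
have t1 i : bad1 i < t by apply: Ht; rewrite mem_cat map_f // mem_enum.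
have t2 z : bad2 z < t by apply: Ht; rewrite mem_cat [X in _ || X]map_f ?orbT // mem_enum.
pose d i := B i - t * A i.
have d0 i : d i != 0.
  apply/eqP => di; have [Ai|Ai] := eqVneq (A i) 0.
    by move: di (AB_neq0 i); rewrite /d Ai mulr0 subr0 => ->; apply.
  have := t1 i; rewrite /bad1 (_ : B i = t * A i) ?mulfK ?ltxx //.
  by apply/eqP; rewrite -subr_eq0; apply/eqP.
pose px x := (pt x).1 + t * (pt x).2; pose py x := (pt x).2.
pose a i := - A i / d i; pose b i := C i / d i.
have onE (q : R * R) i : (q.2 == a i * (q.1 + t * q.2) + b i) = (A i * q.1 + B i * q.2 == C i).
  rewrite /a /b mulrAC -mulrDl -(inj_eq (mulIf (d0 i))) divfK //.
  by rewrite -subr_eq0 -[RHS]subr_eq0 /d; congr (_ == 0); ring.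
have heightE i x : height a b i (px x) = py x + e i x / d i.
  rewrite /height /px /py /a /b /e; apply: (mulIf (d0 i)).
  by rewrite mulrDl mulrAC !divfK // mulrDl divfK // /d; ring.
have on_e x i : on_line px py a b x i = (e i x == 0).
  by rewrite /on_line onE /e -subr_eq0 -oppr_eq0; congr (_ == 0); ring.
exists px, py, a, b; split=> [x i||x i j ij].
- exact: onE.
- move=> x y i j xy /eqP xi /eqP yi /eqP xj /eqP yj.
  have pxy : px x != px y.
    apply: contraNneq xy => pE; apply/eqP/pt_inj.
    have pyE : py x = py y by rewrite xi yi pE.
    move: pE; rewrite /px -/(py x) -/(py y) pyE => /addIr.
    by move: pyE; rewrite /py; case: (pt x) (pt y) => [? ?] [? ?] /= -> ->.
  have aE : a i = a j.
    apply: (mulIf (_ : px x - px y != 0)); first by rewrite subr_eq0.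
    by move: xi yi xj yj; rewrite /height; lra.
  have bE : b i = b j by move: xi xj; rewrite /height aE; lra.
  by apply: line_inj => q; rewrite -!onE aE bE.
rewrite !heightE => /addrI /eqP; rewrite eqr_div // => /eqP ed.
rewrite on_e; apply/negPn/negP => ei0.
have key : t * (e i x * A j - e j x * A i) = e i x * B j - e j x * B i.
  by move: ed; rewrite /d; lra.
have [den0|den0] := eqVneq (e i x * A j - e j x * A i) 0; last first.
  by have := t2 (i, j, x); rewrite /bad2 /= -key mulfK // ltxx.
have num0 : e i x * B j - e j x * B i = 0 by rewrite -key den0 mulr0.
have ej0 : e j x != 0.
  apply/eqP => ej; apply: (AB_neq0 j).
  move: den0 num0; rewrite ej !mul0r !subr0 => /eqP; rewrite mulf_eq0 (negPf ei0) /= => /eqP ->.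
  by move=> /eqP; rewrite mulf_eq0 (negPf ei0) /= => /eqP ->.
move: ij => /eqP; apply; apply: line_inj => q.
(* With both coefficients vanishing, the two equations are proportional with nonzero factors, so the
   lines coincide. *)
have prop : e i x * (A j * q.1 + B j * q.2 - C j) = e j x * (A i * q.1 + B i * q.2 - C i).
  have hC k : C k = e k x + A k * (pt x).1 + B k * (pt x).2 by rewrite /e; ring.
  rewrite (hC i) (hC j); apply/eqP; rewrite -subr_eq0; apply/eqP.
  rewrite [LHS](_ : _ = (e i x * A j - e j x * A i) * (q.1 - (pt x).1)
    + (e i x * B j - e j x * B i) * (q.2 - (pt x).2)); last by ring.
  by rewrite den0 num0 !mul0r addr0.
rewrite -subr_eq0 -[RHS]subr_eq0.
by rewrite -[LHS](mulrI_eq0 _ (mulfI ej0)) -prop (mulrI_eq0 _ (mulfI ei0)).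
Qed.

(* Transfer to finite sets of points and lines of the real plane *)
From mathcomp Require Import finmap classical_sets reals exp.

Local Open Scope classical_set_scope.
Local Open Scope fset_scope.
Local Open Scope ring_scope.

(** The vectors [q - p] and [r - p] are orthogonal to the nonzero [(a, b)], hence parallel; as
    [(a', b')] is orthogonal to the nonzero [q - p], it is orthogonal to [r - p]. *)
Lemma is_line_sub (R : realType) (l l' : set (R * R)) (p q : R * R) :
  is_line l -> is_line l' -> p <> q -> l p -> l q -> l' p -> l' q -> (l `<=` l')%classic.
Proof.
move=> [a [b [c [ab ->]]]] [a' [b' [c' [_ ->]]]] pq /= lp lq lp' lq' r /= lr.
pose u1 := q.1 - p.1; pose u2 := q.2 - p.2; pose v1 := r.1 - p.1; pose v2 := r.2 - p.2.
have au : a * u1 + b * u2 = 0 by rewrite /u1 /u2; lra.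
have av : a * v1 + b * v2 = 0 by rewrite /v1 /v2; lra.
have au' : a' * u1 + b' * u2 = 0 by rewrite /u1 /u2; lra.
have det0 : v1 * u2 - v2 * u1 = 0.
  apply/eqP; apply: contra_notT ab => det.
  have a0 : a * (v1 * u2 - v2 * u1) = 0.
    by rewrite [LHS](_ : _ = (a * v1 + b * v2) * u2 - (a * u1 + b * u2) * v2); [rewrite au av; ring | ring].
  have b0 : b * (v1 * u2 - v2 * u1) = 0.
    by rewrite [LHS](_ : _ = (a * u1 + b * u2) * v1 - (a * v1 + b * v2) * u1); [rewrite au av; ring | ring].
  move: a0 b0 => /eqP + /eqP; rewrite !mulf_eq0 (negPf det) !orbF.
  by move=> /eqP -> /eqP ->.
have h1 : u1 * (a' * v1 + b' * v2) = 0.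
  rewrite [LHS](_ : _ = (a' * u1 + b' * u2) * v1 - b' * (v1 * u2 - v2 * u1)); last by ring.
  by rewrite au' det0; ring.
have h2 : u2 * (a' * v1 + b' * v2) = 0.
  rewrite [LHS](_ : _ = (a' * u1 + b' * u2) * v2 + a' * (v1 * u2 - v2 * u1)); last by ring.
  by rewrite au' det0; ring.
suff : a' * v1 + b' * v2 = 0 by rewrite /v1 /v2; lra.
apply/eqP; apply: contra_notT pq => nz.
move: h1 h2 => /eqP + /eqP; rewrite !mulf_eq0 (negPf nz) !orbF !subr_eq0.
by case: p q {lp lq lp' lq' u1 u2 v1 v2 au av au' det0 nz} => [? ?] [? ?] /= /eqP -> /eqP ->.
Qed.

Lemma is_line_unique (R : realType) (l l' : set (R * R)) (p q : R * R) :
  is_line l -> is_line l' -> p <> q -> l p -> l q -> l' p -> l' q -> l = l'.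
Proof.
by move=> ll ll' pq lp lq lp' lq'; apply/seteqP; split; apply: is_line_sub pq _ _ _ _.
Qed.

Theorem theorem1 (R : realType) (k : nat) (c : R) (c_gt0 : 0 < c) :
  exists n0 : nat, forall (n : nat) (L : {fset set (R * R)}) (P : {fset R * R}),
    (n0 <= n)%N ->
    (forall l : set (R * R), l \in L -> is_line l) ->
    #|` L| = n ->
    #|` P| = n ->
    c * n%:R `^ (4 / 3) <= #|` incidences P L|%:R ->
    exists S : {fset R * R},
      [/\ (S `<=` P)%fset, #|` S| = k, general_position S &
          forall p q : R * R, p \in S -> q \in S -> p <> q ->
            exists2 l : set (R * R), l \in L & p \in l /\ q \in l].
Proof.
have [->|k_neq0] := eqVneq k 0%N.
  exists 0%N => n L P _ _ _ _ _; exists fset0.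
  by split=> [|||p q]; rewrite ?fsub0set ?cardfs0 ?inE // => p q r; rewrite inE.
have k_gt0 : (0 < k)%N by rewrite lt0n.
have [nu0 Hnu0] := exists_clique_of_incidences k_gt0 c_gt0.
(* The maximum with 1 keeps the base nonnegative, so that comparing cubes yields [nu0 <= nu]. *)
have [n0 Hn0] := exists_nat_gt (Num.max nu0 1 ^+ 3).
exists n0 => n L P n_ge L_line cL cP Hinc.
pose nu : R := n%:R `^ (1 / 3).
have nu_ge0 : 0 <= nu by apply: powR_ge0.
have nuX m : nu ^+ m = n%:R `^ (m%:R / 3).
  by rewrite -powR_mulrn // -powRrM mulrC mulrA mulr1.
have nu3 : nu ^+ 3 = n%:R by rewrite nuX divff ?powRr1 // pnatr_eq0.
have nu_ge : nu0 <= nu.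
  apply: (@le_trans _ _ (Num.max nu0 1)); first by rewrite le_max lexx.
  rewrite -(@ler_pXn2r _ 3) ?nnegrE //; last by rewrite le_max ler01 orbT.
  by rewrite nu3; apply: le_trans (ltW Hn0) _; rewrite ler_nat.
have /choice[coef coefP] : forall l : L, exists z : R * R * R,
    (z.1.1, z.1.2) <> (0, 0) /\
    fsval l = [set p : R * R | z.1.1 * p.1 + z.1.2 * p.2 = z.2]%classic.
  by move=> l; have [a [b [d [ab lE]]]] := L_line _ (fsvalP l); exists (a, b, d).
pose A l := (coef l).1.1; pose B l := (coef l).1.2; pose C l := (coef l).2.
have memE (l : L) (q : R * R) : (A l * q.1 + B l * q.2 == C l) = (q \in fsval l).
  have [_ lE] := coefP l; rewrite [in RHS]lE; apply/eqP/idP => [h|].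
    by rewrite in_setE.
  by rewrite in_setE.
have [||px [py [a [b [incE lin gen]]]]] := @exists_generic_coordinates R P L
    (fun p => fsval p) A B C val_inj.
- by move=> l; have [] := coefP l.
- move=> l l' ll'; apply: val_inj; apply/seteqP; split=> q /=.
    by rewrite -in_setE -memE ll' memE in_setE.
  by rewrite -in_setE -memE -ll' memE in_setE.
have cPT : #|{: P}| = n by rewrite -cP cardfE.
have cLT : #|{: L}| = n by rewrite -cL cardfE.
have incP (p : P) (l : L) : on_line px py a b p l = (fsval p \in fsval l).
  by rewrite incE memE.
have count : (#|` incidences P L| <= \sum_(l : L) #|points_on (on_line px py a b) l|)%N.
  have -> : (\sum_(l : L) #|points_on (on_line px py a b) l| =
      #|[set z : P * L | fsval z.1 \in fsval z.2]%SET|)%N.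
    rewrite -sum1_card; under [RHS]eq_bigl => z do rewrite inE.
    rewrite -(pair_big_dep predT (fun (p : P) (l : L) => fsval p \in fsval l) (fun _ _ => 1%N)) /=.
    rewrite (exchange_big_dep predT) //=; apply: eq_bigr => l _; rewrite sum1_card.
    by apply: eq_card => p; rewrite inE incP.
  rewrite cardfE.
  have hP (z : incidences P L) : (fsval z).1 \in P.
    by have := fsvalP z; rewrite !inE => /andP[/andP[]].
  have hL (z : incidences P L) : (fsval z).2 \in L.
    by have := fsvalP z; rewrite !inE => /andP[/andP[]].
  pose h (z : incidences P L) : P * L := ([` hP z], [` hL z])%fset.
  have h_inj : injective h.
    move=> z z' [h1 h2]; apply: val_inj => /=.
    by case: (fsval z) (fsval z') h1 h2 => [? ?] [? ?] /= -> ->.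
  rewrite -(card_codom h_inj); apply/subset_leq_card/fintype.subsetP => _ /codomP[z ->].
  by rewrite inE /=; have := fsvalP z; rewrite !inE => /andP[_]; rewrite in_setE.
have [|||W [uW sW adjW colW]] := Hnu0 P L px py a b nu lin gen nu_ge.
- by rewrite nu3 cPT.
- by rewrite cPT cLT.
- by rewrite nuX; apply: le_trans Hinc _; rewrite ler_nat.
exists [fset x in [seq fsval p | p <- W]]%fset.
have inS x : x \in [fset x in [seq fsval p | p <- W]]%fset -> exists2 p : P, p \in W & x = fsval p.
  by rewrite inE => /mapP.
split.
- by apply/fsubsetP => x /inS[p _ ->]; apply: fsvalP.
- by rewrite card_fseq undup_id ?size_map // map_inj_uniq //; apply: val_inj.
- move=> _ _ _ /inS[p pW ->] /inS[q qW ->] /inS[r rW ->] pq pr qr [l l_line [lp lq lr]].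
  have pq' : p != q by apply/eqP => E; apply: pq; rewrite E.
  have pr' : p != r by apply/eqP => E; apply: pr; rewrite E.
  have qr' : q != r by apply/eqP => E; apply: qr; rewrite E.
  have [i /andP[pi qi]] := adjW _ _ pW qW pq'.
  (* The line [l] is arbitrary in the plane, but it shares two points with a line of [L] and so
     equals it. *)
  have lE : l = fsval i.
    apply: (is_line_unique l_line (L_line _ (fsvalP i)) pq lp lq); rewrite -in_setE -incP //.
  have := colW _ _ _ pW qW rW pq' pr' qr' i; rewrite pi qi /= incP -lE.
  by move/negP; apply; rewrite in_setE.
- move=> _ _ /inS[p pW ->] /inS[q qW ->] pq.
  have pq' : p != q by apply/eqP => E; apply: pq; rewrite E.
  have [i /andP[pi qi]] := adjW _ _ pW qW pq'.
  by exists (fsval i); [exact: fsvalP | rewrite -!incP].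
Qed.
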